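(* Let $M_1\subset\subset M_2$ be two smooth compact connected manifolds with boundary. Let $G$ and $\tilde G$ be two Riemannian metrics on $M_2$ such that $G=\tilde G$ on $M_2\setminus M_1$. For $j=1,2$, denote by $\Lambda_{G,j}$ and $\Lambda_{\tilde G,j}$ the Dirichlet-to-Neumann maps on $\partial M_j$ associated to $G$ and $\tilde G$ on $M_j$. Then $$\Lambda_{G,1}=\Lambda_{\tilde G,1}\ \Longrightarrow\ \Lambda_{G,2}=\Lambda_{\tilde G,2}.$$
   Context: $M_1\subset\subset M_2$ means that $M_1$ is a compact domain with smooth boundary (of the same dimension as $M_2$) contained in the interior of $M_2$. Riemannian metrics are smooth. For a compact Riemannian manifold $(M,G)$ with boundary and $f\in H^{1/2}(\partial M)$, let $u\in H^1(M)$ be the unique weak solution of $-\Delta_G u=0$ on $M$, $u=f$ on $\partial M$, where $\Delta_G$ is the Laplace-Beltrami operator. The Dirichlet-to-Neumann map $\Lambda_G:H^{1/2}(\partial M)\to H^{-1/2}(\partial M)$ is $\Lambda_Gf=(\partial_\nu u)|_{\partial M}$, where $\nu$ is the unit outer normal for $G$. The normal derivative is understood weakly via $\langle\Lambda_Gf,h\rangle=\int_M\langle du,dv\rangle_G\,d\mathrm{Vol}_G$, for $h\in H^{1/2}(\partial M)$ and any $v\in H^1(M)$ with $v|_{\partial M}=h$. *)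

(* Defs.v *)
From HB Require Import structures.
From mathcomp Require Import all_boot all_order all_algebra.
From mathcomp Require Import all_classical all_reals all_analysis.
Set Implicit Arguments.
Unset Strict Implicit.
Unset Printing Implicit Defensive.
Import Order.TTheory GRing.Theory Num.Theory.
Import numFieldNormedType.Exports.
Local Open Scope classical_set_scope.
Local Open Scope ring_scope.

Section Euclidean.
Variable R : realType.

Fixpoint lebesgue_tuple (n : nat) :
    set (n.-tuple (measurableTypeR R)) -> \bar R :=
  match n with
  | 0 => dirac [tuple]
  | k.+1 =>
    pushforward (lebesgue_measure \x @lebesgue_tuple k)%E
      (fun p : measurableTypeR R * k.-tuple (measurableTypeR R) =>
         [tuple of p.1 :: p.2])
  end.

Definition vec (n : nat) (t : n.-tuple (measurableTypeR R)) : 'rV[R]_n :=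
  \row_i tnth t i.

Definition partial (n : nat) (a : 'I_n) (F : 'rV[R]_n -> R) (x : 'rV[R]_n) : R :=
  'D_(delta_mx 0 a) F x.

Fixpoint is_Ck (n k : nat) (V : set 'rV[R]_n) (F : 'rV[R]_n -> R) : Prop :=
  (forall x, V x -> {for x, continuous F}) /\
  match k with
  | 0 => True
  | l.+1 => forall a : 'I_n,
      (forall x, V x -> derivable F x (delta_mx 0 a)) /\
      is_Ck l V (partial a F)
  end.

(* [A] need not be open: smoothness up to the boundary of a half-space means
   local extendability to a smooth function on an open set. *)
Definition smooth_on (n : nat) (A : set 'rV[R]_n) (F : 'rV[R]_n -> R) : Prop :=
  forall x, A x -> exists V H,
    [/\ open V, V x, forall k, is_Ck k V H & forall y, A y -> V y -> H y = F y].

Definition half_space (m : nat) : set 'rV[R]_m.+1 := [set x | 0 <= x 0 0].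

End Euclidean.

(* Compact smooth manifold with boundary of dimension m.+1, presented by a
   finite smooth atlas modelled on the half-space. [phi i] and [psi i] are total
   functions, meaningful on [dom i] and on [phi i @` dom i] only. *)
Record compact_manifold (R : realType) (m : nat) (T : topologicalType) := {
  charts : nat ;
  dom : 'I_charts -> set T ;
  phi : 'I_charts -> T -> 'rV[R]_m.+1 ;
  psi : 'I_charts -> 'rV[R]_m.+1 -> T ;
  manifold_hausdorff : hausdorff_space T ;
  manifold_compact : compact [set: T] ;
  dom_cover : forall p, exists i, dom i p ;
  dom_open : forall i, open (dom i) ;
  phi_continuous : forall i, {within dom i, continuous (phi i)} ;
  phi_image : forall i, exists2 O, open O &
    phi i @` dom i = O `&` @half_space R m ;
  phiK : forall i p, dom i p -> psi i (phi i p) = p ;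
  psi_continuous : forall i, {within phi i @` dom i, continuous (psi i)} ;
  transition_smooth : forall i j a,
    smooth_on (phi i @` (dom i `&` dom j)) (fun x => phi j (psi i x) 0 a)
}.

Section Manifold.
Variables (R : realType) (m : nat) (T : topologicalType).
Variable M : compact_manifold R m T.
Local Notation n := m.+1.
Local Notation chart := 'I_(charts M).

Definition manifold_interior : set T :=
  [set p | forall i : chart, dom i p -> 0 < phi i p 0 0].

Definition manifold_boundary : set T := ~` manifold_interior.

(* [M1] is a compact domain with smooth boundary in the interior of [M]: near
   each boundary point a diffeomorphism [F] of an open set straightens [M1] to a
   half-space. *)
Definition smooth_domain (M1 : set T) : Prop :=
  [/\ compact M1, M1 `<=` manifold_interior &
    forall p, (M1 `\` interior M1) p ->
    exists (i : chart) (W : set 'rV[R]_n) (F F' : 'rV[R]_n -> 'rV[R]_n),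
    [/\ dom i p, open W, W (phi i p) & W `<=` phi i @` dom i] /\
    [/\ open (F @` W), forall x, W x -> F' (F x) = x,
        forall a, smooth_on W (fun x => F x 0 a),
        forall a, smooth_on (F @` W) (fun y => F' y 0 a) &
        forall x, W x -> (M1 (psi i x) <-> 0 <= F x 0 0)]].

(* A (0,2)-tensor field, by its components in each chart. *)
Definition tensor := chart -> 'rV[R]_n -> 'M[R]_n.

(* [jacobian i j x] acts on row vectors on the right: it sends the components of
   a tangent vector in chart [i] to those in chart [j]. *)
Definition jacobian (i j : chart) (x : 'rV[R]_n) : 'M[R]_n :=
  \matrix_(a, b) partial a (fun y => phi j (psi i y) 0 b) x.

(* The transformation law is required at interior points only, where the
   transition maps are defined on open sets; it extends to the boundary by
   continuity. *)
Definition riemannian (g : tensor) : Prop :=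
  [/\ forall i a b, smooth_on (phi i @` dom i) (fun x => g i x a b),
      forall i p, dom i p -> (g i (phi i p))^T = g i (phi i p),
      forall i p (v : 'rV[R]_n), dom i p -> v != 0 ->
        0 < (v *m g i (phi i p) *m v^T) 0 0 &
      forall i j p, dom i p -> dom j p -> manifold_interior p ->
        g i (phi i p) =
        jacobian i j (phi i p) *m g j (phi j p) *m (jacobian i j (phi i p))^T].

(* The part of [Om] whose first chart is [i], in the coordinates of chart [i]:
   these parts form a partition of [Om]. *)
Definition piece (Om : set T) (i : chart) : set (n.-tuple (measurableTypeR R)) :=
  [set t | (phi i @` dom i) (vec t) /\ Om (psi i (vec t)) /\
           forall j : chart, (j < i)%N -> ~ dom j (psi i (vec t))].

(* Integral over [Om] against the Riemannian volume of [g]; the integrand is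
   given in the coordinates of each chart, and only its values on the pieces
   matter. *)
Definition integral_vol (g : tensor) (Om : set T) (F : chart -> 'rV[R]_n -> R) :
    \bar R :=
  (\sum_(i : chart) \int[@lebesgue_tuple R n]_(t in piece Om i)
     (F i (vec t) * Num.sqrt (\det (g i (vec t))))%:E)%E.

Definition inner (g : tensor) (i : chart) (x a b : 'rV[R]_n) : R :=
  (a *m invmx (g i x) *m b^T) 0 0.

(* A function together with its differential, the latter given by its components
   in each chart. *)
Definition fun_diff : Type := ((T -> R) * (chart -> 'rV[R]_n -> 'rV[R]_n))%type.

Definition with_diff (f : T -> R) : fun_diff :=
  (f, fun i x => \row_a partial a (f \o psi i) x).

Definition zero_diff : fun_diff := with_diff (cst 0).

Definition dirichlet (g : tensor) (Om : set T) (u v : fun_diff) : \bar R :=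
  integral_vol g Om (fun i x => inner g i x (u.2 i x) (v.2 i x)).

Definition H1_sqdist (g : tensor) (Om : set T) (u v : fun_diff) : \bar R :=
  integral_vol g Om (fun i x =>
    (u.1 (psi i x) - v.1 (psi i x)) ^+ 2 +
    inner g i x (u.2 i x - v.2 i x) (u.2 i x - v.2 i x)).

(* In what follows a compact manifold with boundary is given by the compact set
   [K] of its points and by its interior [Om]; its boundary is [K `\` Om], a null
   set, so that integrals are taken over [Om]. *)

Definition smooth_fun (K : set T) (f : T -> R) : Prop :=
  forall i : chart, smooth_on (phi i @` (dom i `&` K)) (f \o psi i).

(* The H^1 norms of all Riemannian metrics on [M] are equivalent; quantifying
   over the metric makes H^1 independent of it. *)
Definition H1_cvg (Om : set T) (f : nat -> T -> R) (u : fun_diff) : Prop :=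
  forall g, riemannian g ->
    H1_sqdist g Om (with_diff (f k)) u @[k --> \oo] --> 0%E.

(* H^1 as the L^2-closure of the pairs (f, df), f smooth up to the boundary.
   Elements are functions, not classes modulo a.e. equality. *)
Definition H1 (K Om : set T) (u : fun_diff) : Prop :=
  [/\ forall i : chart, measurable_fun (piece Om i) (fun t => u.1 (psi i (vec t))),
      forall (i : chart) a, measurable_fun (piece Om i) (fun t => u.2 i (vec t) 0 a),
      forall g, riemannian g -> (H1_sqdist g Om u zero_diff < +oo)%E &
      exists2 f, forall k, smooth_fun K (f k) & H1_cvg Om f u].

(* Equality of boundary values. The trace is the continuous extension to H^1 of
   the restriction of smooth functions to the boundary, with values in H^{1/2},
   the completion of these restrictions in the norm
   inf { |f|_{H^1} : f smooth with the given restriction }.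
   Hence two elements of H^1 have the same trace iff they are limits of smooth
   functions which agree on the boundary. *)
Definition same_trace (K Om : set T) (u v : fun_diff) : Prop :=
  exists f h : nat -> T -> R,
    [/\ forall k, smooth_fun K (f k), forall k, smooth_fun K (h k),
        forall k p, (K `\` Om) p -> f k p = h k p,
        H1_cvg Om f u & H1_cvg Om h v].

Definition trace (K Om : set T) (u : fun_diff) : set fun_diff :=
  [set v | H1 K Om v /\ same_trace K Om u v].

Definition Hhalf (K Om : set T) : Type :=
  {f : set fun_diff | exists2 u, H1 K Om u & f = trace K Om u}.

Definition weak_harmonic (g : tensor) (K Om : set T) (u : fun_diff) : Prop :=
  forall v, H1 K Om v -> same_trace K Om v zero_diff ->
    dirichlet g Om u v = 0%E.

(* The graph of the Dirichlet-to-Neumann map: the pairs (f, l) such that the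
   functional l is h |-> \int_K <du, dv>_g, where u is the weak solution with
   boundary values f, and v is any element of H^1 with boundary values h. Such an
   l is automatically linear and bounded, i.e. an element of H^{-1/2}. *)
Definition DN_map (g : tensor) (K Om : set T) :
    set (Hhalf K Om * (Hhalf K Om -> R)) :=
  [set L | exists u,
    [/\ H1 K Om u, trace K Om u = sval L.1, weak_harmonic g K Om u &
        forall (h : Hhalf K Om) v, H1 K Om v -> trace K Om v = sval h ->
          (L.2 h)%:E = dirichlet g Om u v]].

End Manifold.

Arguments DN_map {R m T M} g K Om.

(* Main.v *)
(* Let u be G-harmonic on M2.  Its restriction to M1 is G-harmonic, because a test
   function of H^1_0(M1), extended by zero, is a test function on M2; so the
   boundary values of u on the boundary of M1, paired with the functional
   h |-> int_M1 <du, dv>_G (v with boundary values h), lie in the graph of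
   Lambda_{G,1}, hence in that of Lambda_{Gt,1}.  Membership in the latter graph
   provides a Gt-harmonic w on M1 with the boundary values of u, so that no
   existence theorem for the Dirichlet problem is needed.  Then z, equal to w in M1
   and to u elsewhere, is in H^1(M2), has the boundary values of u, and
   int_M2 <dz, dv>_Gt = int_M2 <du, dv>_G for every v, since the integrals over M1
   agree by the equality of the two functionals, and z = u, G = Gt elsewhere.

   The analytic point is that extension by zero maps H^1_0(M1) to H^1_0(M2).  For w
   smooth on M1 and zero on its boundary, chi_c(w), where
   chi_c(t) = t exp(-1/((ct)^2 - 1)) for |ct| > 1 and 0 otherwise, vanishes near that
   boundary, hence extends smoothly by zero, and it tends to w in H^1 as c tends to
   infinity: dominated convergence applies because dw = 0 almost everywhere on
   {w = 0}.  As H^1 convergence is required for all metrics at once, the diagonal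
   extraction uses that all Riemannian metrics on the compact M2 are comparable. *)
From HB Require Import structures.
Require Import Defs.
From mathcomp Require Import all_boot all_order all_algebra.
From mathcomp Require Import all_classical all_reals all_analysis.
From mathcomp Require Import measurable_realfun.
From mathcomp Require Import ring lra.
Set Implicit Arguments.
Unset Strict Implicit.
Unset Printing Implicit Defensive.
Import Order.TTheory GRing.Theory Num.Theory.
Import numFieldNormedType.Exports.
Local Open Scope classical_set_scope.
Local Open Scope ring_scope.

(** * Lebesgue measure on tuples *)

Section TupleMeasure.
Variable R : realType.
Local Notation mR := (measurableTypeR R).
Local Notation tup n := (n.-tuple mR).

Definition cons_tup n (p : mR * tup n) : tup n.+1 := [tuple of p.1 :: p.2].

Lemma measurable_cons_tup n : measurable_fun [set: mR * tup n] (@cons_tup n).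
Proof. exact: measurable_cons. Qed.

Definition uncons_tup n (t : tup n.+1) : mR * tup n := (thead t, [tuple of behead t]).

Lemma cons_tupK n : cancel (@cons_tup n) (@uncons_tup n).
Proof.
by move=> [x t]; rewrite /uncons_tup/cons_tup /= theadE; congr pair; apply: val_inj.
Qed.

Lemma measurable_uncons_tup n : measurable_fun [set: tup n.+1] (@uncons_tup n).
Proof.
apply/measurable_fun_pairP; split; first exact: (@measurable_tnth _ mR n.+1 ord0).
exact: measurable_behead.
Qed.

(** An exhaustion by sets of finite measure is carried over by the inverse map [uncons_tup]: the
    rectangles [F k] times [H k] are pulled back along it, and pulling back once more along
    [cons_tup] returns the rectangles themselves. *)
Lemma pushforward_cons_sigma_finite n (l : {sigma_finite_measure set mR -> \bar R})
    (mu : {sigma_finite_measure set (tup n) -> \bar R}) :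
  exists mu' : {sigma_finite_measure set (tup n.+1) -> \bar R},
    mu' = pushforward (l \x mu)%E (@cons_tup n) :> (set _ -> \bar R).
Proof.
pose nu : {measure set _ -> \bar R} := (l \x mu)%E.
pose pf : {measure set (tup n.+1) -> \bar R} :=
  @measure_function_pushforward__canonical__measure_function_Measure
    _ _ _ _ _ nu _ (@measurable_cons_tup n).
have sf : sigma_finite setT pf.
  have /sigma_finiteP[F [FT ndF Foo]] := sigma_finiteT l.
  have /sigma_finiteP[H [HT ndH Hoo]] := sigma_finiteT mu.
  exists (fun k => @uncons_tup n @^-1` (F k `*` H k)).
    apply/seteqP; split=> // t _.
    have [i _ Fi] : (\bigcup_k F k) (uncons_tup t).1 by rewrite -FT.
    have [j _ Hj] : (\bigcup_k H k) (uncons_tup t).2 by rewrite -HT.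
    exists (maxn i j) => //; split.
      by move: Fi; exact/subsetPset/ndF/leq_maxl.
    by move: Hj; exact/subsetPset/ndH/leq_maxr.
  move=> k; have [mF Fk] := Foo k; have [mH Hk] := Hoo k; split.
    rewrite -[X in measurable X]setTI; apply: measurable_uncons_tup => //.
    exact: measurableX.
  rewrite /= /pushforward -comp_preimage (_ : _ \o _ = id) ?preimage_id; last first.
    by apply/funext => p /=; rewrite cons_tupK.
  by rewrite product_measure1E// lte_mul_pinfty// ge0_fin_numE.
pose S := @Measure_isSigmaFinite.Build _ _ _ pf sf.
pose sfm : {sigma_finite_measure set (tup n.+1) -> \bar R} := HB.pack (Measure.sort pf) (Measure.class pf) S.
by exists sfm.
Qed.

(** [lebesgue_tuple] is defined as a bare set function; the integration theorems apply once it is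
    recognised as a sigma-finite measure. *)
Lemma lebesgue_tuple_sigma_finite n :
  exists mu : {sigma_finite_measure set (tup n) -> \bar R},
    mu = @lebesgue_tuple R n :> (set _ -> \bar R).
Proof.
elim: n => [|n [mu muE]]; first by exists (dirac ([tuple] : tup 0)).
have [mu' mu'E] := pushforward_cons_sigma_finite (@lebesgue_measure R) mu.
by exists mu'; rewrite mu'E /= -muE.
Qed.

Definition set_tup n (t : tup n) (a : 'I_n) (s : R) : tup n :=
  [tuple (if i == a then s else tnth t i) | i < n].

(** Fubini, by induction on [n]. If [a] is not the first coordinate, slice by the first one and use
    induction. If it is, uniqueness of the product measure lets the slicing be done by the tail, and
    the remaining one-dimensional sections are countable, hence null. *)
Lemma lebesgue_tuple_countable_lines n (mu : {measure set (tup n) -> \bar R})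
    (a : 'I_n) (A : set (tup n)) :
  mu = @lebesgue_tuple R n :> (set _ -> \bar R) -> measurable A ->
  (forall t, countable [set s | A (set_tup t a s)]) -> mu A = 0%E.
Proof.
elim: n mu a A => [|n IH] mu a A muE mA cA; first by case: a cA.
have [nu nuE] := lebesgue_tuple_sigma_finite n.
rewrite muE /= /pushforward -nuE.
set B := _ @^-1` A.
have mB : measurable B.
  by rewrite -[B]setTI; exact: (@measurable_cons_tup n).
pose l : {sigma_finite_measure set mR -> \bar R} := @lebesgue_measure R.
have lE : @lebesgue_measure R = l by [].
rewrite -[LHS]/(product_measure1 (@lebesgue_measure R) nu B) lE; clearbody l.
case: (unliftP ord0 a) => [b|] aE.
  rewrite /product_measure1 integral0_eq// => x _ /=.
  apply: (IH nu b) => //; first exact: measurable_xsection.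
  move=> t; apply: sub_countable (cA (cons_tup (x, t))).
  apply: subset_card_le => s /set_mem; rewrite /B /=.
  rewrite (_ : [tuple of _ :: _] = set_tup (cons_tup (x, t)) a s)//.
  apply: eq_from_tnth => i; rewrite tnth_mktuple aE.
  case: (unliftP ord0 i) => [j|] -> /=.
    by rewrite !tnthS tnth_mktuple (inj_eq lift_inj).
  by rewrite !tnth0.
rewrite (@product_measure_unique _ _ _ _ _ l nu (l \x^ nu)%E)//; last first.
  by move=> *; exact: product_measure2E.
transitivity (\int[nu]_t (l \o ysection B) t)%E => //.
rewrite integral0_eq// => t _ /=.
rewrite -lE; apply: countable_lebesgue_measure0.
apply: sub_countable (cA (cons_tup (0, t))).
apply: subset_card_le => s /set_mem; rewrite /B /=.
rewrite (_ : [tuple of _ :: _] = set_tup (cons_tup (0, t)) a s)//.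
apply: eq_from_tnth => i; rewrite tnth_mktuple aE.
case: (unliftP ord0 i) => [j|] -> /=; first by rewrite !tnthS.
by rewrite tnth0.
Qed.

End TupleMeasure.

(** * Borel sets of row vectors and relative continuity *)

Section Borel.
Variable R : realType.
Variable n : nat.
Local Notation mR := (measurableTypeR R).
Local Notation tup := (n.-tuple mR).
Local Notation rV := ('rV[R]_n).

(** The sigma-algebra on tuples is generated by coordinates, so an open set is written as a
    countable union of boxes with rational centre and radius; boxes not contained in [O] are
    replaced by the empty set. *)
Lemma measurable_vec_open (O : set rV) : open O -> measurable (@vec R n @^-1` O).
Proof.
move=> oO.
pose box (c : 'rV[rat]_n * rat) : set rV :=
  [set x | forall i, `|ratr (c.1 0 i) - x 0 i| < ratr c.2].
rewrite (_ : _ @^-1` O = \bigcup_(c in [set: 'rV[rat]_n * rat])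
    (if `[< box c `<=` O >] then @vec R n @^-1` (box c) else set0)).
  apply: countable_bigcupT_measurable; first exact: countableP.
  move=> c; case: ifPn => // _.
  rewrite (_ : _ @^-1` _ = \bigcap_(i in [set: 'I_n])
     ((fun t : tup => tnth t i) @^-1` [set y : mR | `|ratr (c.1 0 i) - y| < ratr c.2])).
    apply: fin_bigcap_measurable; first exact: finite_finset.
    move=> i _; rewrite -[X in measurable X]setTI.
    apply: measurable_tnth => //; apply: open_measurable.
    exact: (@ball_open R R^o).
  apply/seteqP; split => t /= H i; first by move=> _; have := H i; rewrite mxE.
  by rewrite mxE; exact: H.
apply/seteqP; split => [t Ot|t [c _]]; last by case: asboolP => // cO; apply: cO.
have /nbhs_ballP[e /= e0 eO] : nbhs (vec t) O by exact: open_nbhs_nbhs.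
have [q] := rat_in_itvoo (divr_gt0 e0 (ltr0n _ 2)); rewrite in_itv /= => /andP[q0 qe].
have /choice[c cP] (i : 'I_n) : exists r : rat, `|ratr r - vec t 0 i| < ratr q.
  have [r] := @rat_in_itvoo R (vec t 0 i) (vec t 0 i + ratr q) ltac:(by rewrite ltrDl).
  rewrite in_itv /= => /andP[r1 r2]; exists r.
  by rewrite ger0_norm ?subr_ge0 ?(ltW r1)// ltrBlDl.
exists (\row_i c i, q) => //; case: asboolP => [_|[]] /=.
  by move=> i /=; rewrite mxE; exact: cP.
move=> x bx; apply: eO; split => // i j; rewrite !ord1 /ball /=.
have := bx j; have := cP j; rewrite /= !mxE => H1 H2.
rewrite -[_ - _](subrKA (ratr (c j))).
by rewrite (le_lt_trans (ler_normD _ _))// (splitr e) ltrD// ?(lt_trans H2)//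
   distrC (lt_trans H1).
Qed.

(** Continuity relative to [A]. Chart images are open only relative to the half-space, and functions
    read in a chart carry meaning only there. *)
Definition cwithin (A : set rV) (F : rV -> R) :=
  forall x, A x -> F @ within A (nbhs x) --> F x.

Lemma cwithin_preimage (A : set rV) (T : topologicalType) (F : rV -> T) (U : set T) :
  (forall x, A x -> F @ within A (nbhs x) --> F x) ->
  open U -> exists2 O, open O & A `&` F @^-1` U = A `&` O.
Proof.
move=> cF oU; exists (interior [set y | A y -> U (F y)]).
  exact: open_interior.
apply/seteqP; split=> x [Ax].
  move=> Ux; split=> //; apply: (cF x Ax); exact: open_nbhs_nbhs.
by move=> /interior_subset /= /(_ Ax).
Qed.

Lemma measurable_cwithin (A : set rV) (F : rV -> R) :
  measurable (@vec R n @^-1` A) -> cwithin A F ->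
  measurable_fun (@vec R n @^-1` A) (fun t : tup => F (vec t)).
Proof.
move=> mA cF; apply: (measurability _ (RGenOpens.measurableE R)).
move=> _ [_ [a [b ->] <-]].
have oab : open (`]a, b[%classic : set R) by exact: interval_open.
have [V oV AV] := cwithin_preimage cF oab.
rewrite -[X in measurable X]/(@vec R n @^-1` (A `&` F @^-1` `]a, b[%classic)) AV.
by apply: measurableI => //; exact: measurable_vec_open.
Qed.

Lemma continuous_cwithin (A : set rV) F :
  (forall x, A x -> {for x, continuous F}) -> cwithin A F.
Proof. by move=> cF x Ax; apply: cvg_within_filter; exact: cF. Qed.

Lemma smooth_on_cwithin A F : smooth_on A F -> cwithin A F.
Proof.
move=> sF x Ax; have [V [H [oV Vx /(_ 0%N)[cH _] HF]]] := sF x Ax.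
have cHx : H @ within A (nbhs x) --> F x.
  by rewrite -HF//; apply: cvg_within_filter; exact: cH.
apply: cvg_trans cHx; apply: near_eq_cvg; rewrite near_withinE.
have : nbhs x V by exact: open_nbhs_nbhs.
by apply: filterS => y Vy Ay; rewrite HF.
Qed.
End Borel.

(** * Flat functions and functions of class C^k *)

Section Flat.
Variable R : realType.
Implicit Types (P : {poly R}) (x y : R).

(** The functions P(1/x) exp(-1/x), continued by zero. A polynomial factor is allowed so that the
    family is stable under differentiation. *)
Definition flat P x : R := if 0 < x then P.[x^-1] * expR (- x^-1) else 0.

Lemma flat_le0 P x : x <= 0 -> flat P x = 0.
Proof. by rewrite /flat ltNge => ->. Qed.

(** With y = 1/x >= 1 and d = [size P], |P(y)| is at most y^d times the sum of the absolute
    coefficients, while exp(y) >= y^(d+2)/(d+2)!. The two spare powers give x^2, which forces the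
    derivative at 0 to vanish. *)
Lemma flat_bound P : exists2 C, 0 <= C &
  forall x, 0 < x -> x <= 1 -> `|flat P x| <= C * x ^+ 2.
Proof.
pose d := size P.
exists ((\sum_(i < d) `|P`_i|) * (d.+2)`!%:R).
  by rewrite mulr_ge0// sumr_ge0.
move=> x x0 x1; rewrite /flat x0 normrM (ger0_norm (expR_ge0 _)).
set y := x^-1; have y0 : 0 < y by rewrite invr_gt0.
have y1 : 1 <= y by rewrite invf_ge1.
have -> : x ^+ 2 = y ^+ d * y ^- d.+2.
  by rewrite -(addn2 d) exprD invfM mulrA divff ?mul1r ?expf_neq0 ?gt_eqF// /y exprVn invrK.
rewrite mulrACA; apply: ler_pM => //; last 2 first.
- rewrite horner_coef mulr_suml; apply: le_trans (ler_norm_sum _ _ _) _.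
  apply: ler_sum => i _; rewrite normrM ler_wpM2l// normrX ger0_norm ?(ltW y0)//.
  by rewrite ler_weXn2l// ltnW.
- rewrite expRN -[_%:R]invrK -invfM lef_pV2 ?posrE ?expR_gt0//; last first.
    by rewrite mulr_gt0 ?exprn_gt0// invr_gt0 ltr0n fact_gt0.
  rewrite mulrC; apply: le_trans (expR_ge1Dxn d.+1 (ltW y0)).
  by rewrite lerDr.
Qed.

(** For x > 0 the derivative is x^-2 (P - P')(1/x) exp(-1/x), again of the form [flat]; at 0 the
    difference quotient is O(h) by [flat_bound]. *)
Lemma is_derive_flat P x : is_derive x (1 : R) (flat P) (flat ('X^2 * (P - P^`())) x).
Proof.
have [x0|x0|->] := ltgtP x 0.
- rewrite [X in is_derive _ _ _ X]flat_le0 ?(ltW x0)//.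
  apply: (@near_eq_is_derive _ _ _ (cst 0)).
  near=> y; rewrite flat_le0// ltW//; near: y; exact: lt_nbhsl.
- apply: (@near_eq_is_derive _ _ _ (fun y : R => P.[y^-1] * expR (- y^-1))).
    near=> y; rewrite /flat (_ : 0 < y)//; near: y; exact: lt_nbhsr.
  have xn0 : x != 0 by rewrite gt_eqF.
  rewrite /flat x0.
  have dV : is_derive x (1 : R) (fun y : R => y^-1) (- x ^- 2).
    by apply: is_derive_eq (is_deriveV xn0 (is_derive_id x 1)) _; rewrite [_%:A]mulr1.
  have dP : is_derive x (1 : R) (fun y : R => P.[y^-1]) (P^`().[x^-1] * - x ^- 2).
    exact: (is_derive1_comp (is_derive_poly P x^-1) dV).
  have dE : is_derive x (1 : R) (fun y : R => expR (- y^-1)) (expR (- x^-1) * x ^- 2).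
    have dN : is_derive x (1 : R) (fun y : R => - y^-1) (x ^- 2).
      by rewrite -[x ^- 2]opprK; exact: is_deriveN dV.
    exact: (@is_derive1_comp _ (@expR R) (fun y => - y^-1) x _ _ (is_derive_expR (- x^-1)) dN).
  apply: is_derive_eq (is_deriveM dP dE) _.
  by rewrite !hornerE /GRing.scale /= exprVn; ring.
- rewrite [X in is_derive _ _ _ X]flat_le0//.
  have [C C0 CP] := flat_bound P.
  suff H : h^-1 *: (flat P (h *: 1 + 0) - flat P 0) @[h --> 0^'] --> (0:R).
    apply: DeriveDef; first by apply/cvg_ex; exists 0.
    exact: cvg_lim H.
  apply/cvgr0Pnorm_lt => e e0; near=> h.
  rewrite [_%:A]mulr1 addr0 (flat_le0 _ (lexx 0)) subr0.
  have [h0|h0] := leP h 0; first by rewrite flat_le0// scaler0 normr0.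
  have h1 : h <= 1.
    rewrite -[h]gtr0_norm// ltW//; near: h.
    by apply: dnbhs0_lt.
  rewrite normrM normfV (gtr0_norm h0) ltr_pdivrMl//.
  apply: le_lt_trans (CP _ h0 h1) _.
  rewrite expr2 mulrCA ltr_pM2l//.
  (* The constant [C] may be zero, whereas [C + 1] can be inverted. *)
  apply: (@le_lt_trans _ _ ((C + 1) * h)); first by rewrite ler_wpM2r ?lerDl// ltW.
  have C1 : 0 < C + 1 by rewrite ltr_wpDl.
  rewrite -ltr_pdivlMl//; apply: le_lt_trans (ler_norm h) _; near: h.
  by apply: dnbhs0_lt; apply: mulr_gt0 => //; rewrite invr_gt0 ltr_wpDl.
Unshelve. all: by end_near. Qed.

Lemma continuous_flat P : continuous (flat P).
Proof.
by move=> x; apply/differentiable_continuous/derivable1_diffP; case: (is_derive_flat P x).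
Qed.

End Flat.

Section Ck.
Variables (R : realType) (n : nat).
Local Notation rV := ('rV[R]_n).
Implicit Types (V : set rV) (F G : rV -> R) (a : 'I_n) (x : rV).

Lemma derive_line F x (v : rV) :
  'D_v F x = 'D_1 (fun h : R => F (h *: v + x)) 0.
Proof.
rewrite /derive; set g1 := fun h => h^-1 *: _; set g2 := fun h => h^-1 *: _.
suff -> : g1 = g2 by [].
by apply/funext => h; rewrite /g1 /g2 /= addr0 scale0r add0r [_%:A]mulr1.
Qed.

(** The chain rule along one direction, by restriction to a line: only the directional derivative of
    [F] is available from [is_Ck]. *)
Lemma is_derive_comp (f : R -> R) F x (v : rV) b :
  is_derive (F x) 1 f b -> derivable F x v ->
  is_derive x v (f \o F) (b * 'D_v F x).
Proof.
move=> fb /derivable1P dF.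
have fb' : is_derive (F (0 *: v + x)) 1 f b by rewrite scale0r add0r.
have dL := derivableP dF.
have H := @is_derive1_comp _ f (fun h : R => F (h *: v + x)) 0 _ _ fb' dL.
apply: DeriveDef; first by apply/derivable1P; case: H.
by rewrite derive_line -[RHS]/(_ * _) derive_line; case: H.
Qed.

Lemma is_Ck_sub k V V' F : V' `<=` V -> is_Ck k V F -> is_Ck k V' F.
Proof.
move=> sV; elim: k F => [|k IH] F [cF dF]; split=> [x /sV/cF//|] //= a.
by have [d1 d2] := dF a; split=> [x /sV/d1//|]; exact: IH.
Qed.

Lemma is_Ck_ext k V F G : open V -> (forall x, V x -> F x = G x) ->
  is_Ck k V F -> is_Ck k V G.
Proof.
move=> oV; elim: k F G => [|k IH] F G FG [cF dF];
  have nFG x (Vx : V x) : \near x, F x = G x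
    by near=> y; apply: FG; near: y; exact: open_nbhs_nbhs.
  split=> // x Vx; rewrite /prop_for /continuous_at -FG//.
  exact: cvg_trans (near_eq_cvg (nFG x Vx)) (cF x Vx).
split=> [x Vx|a].
  rewrite /prop_for /continuous_at -FG//.
  exact: cvg_trans (near_eq_cvg (nFG x Vx)) (cF x Vx).
have [d1 d2] := dF a; split=> [x Vx|].
  by apply: near_eq_derivable (d1 x Vx); exact: nFG.
apply: IH d2 => x Vx; rewrite /partial; apply: near_eq_derive; exact: nFG.
Unshelve. all: by end_near. Qed.

Lemma is_Ck_pred k V F : is_Ck k.+1 V F -> is_Ck k V F.
Proof.
elim: k F => [|k IH] F [cF dF]; split=> //= a.
by have [d1 d2] := dF a; split=> //; exact: IH.
Qed.

Lemma is_Ck_derivable k V F a x : is_Ck k.+1 V F -> V x -> derivable F x (delta_mx 0 a).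
Proof. by move=> [_ /(_ a)[d _]]; exact: d. Qed.

Lemma is_Ck_cst k V (c : R) : is_Ck k V (cst c).
Proof.
have cc d x : {for x, continuous (cst d : rV -> R)} by exact: cst_continuous.
elim: k c => [|k IH] c; split=> [x _|] //=; try exact: cc.
move=> a; split=> [x _|]; first exact: derivable_cst.
rewrite (_ : partial a (cst c) = cst 0); first exact: IH.
by apply/funext => x; rewrite /partial derive_cst.
Qed.

Lemma is_CkD k V F G : open V -> is_Ck k V F -> is_Ck k V G -> is_Ck k V (F + G).
Proof.
move=> oV; elim: k F G => [|k IH] F G [cF dF] [cG dG].
  by split=> // x Vx; exact: (continuousD (cF x Vx) (cG x Vx)).
split=> [x Vx|a].
  by exact: (continuousD (cF x Vx) (cG x Vx)).
have [f1 f2] := dF a; have [g1 g2] := dG a; split=> [x Vx|].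
  by apply: derivableD; [exact: f1|exact: g1].
apply: (@is_Ck_ext _ _ (partial a F + partial a G)) => //; last exact: IH.
by move=> x Vx; rewrite /partial deriveD//; [exact: f1|exact: g1].
Qed.

Lemma is_CkM k V F G : open V -> is_Ck k V F -> is_Ck k V G -> is_Ck k V (F * G).
Proof.
move=> oV; elim: k F G => [|k IH] F G CF CG.
  have [cF _] := CF; have [cG _] := CG; split=> // x Vx.
  by exact: (continuousM (cF x Vx) (cG x Vx)).
have [cF dF] := CF; have [cG dG] := CG; split=> [x Vx|a].
  by exact: (continuousM (cF x Vx) (cG x Vx)).
have [f1 f2] := dF a; have [g1 g2] := dG a; split=> [x Vx|].
  by apply: derivableM; [exact: f1|exact: g1].
apply: (@is_Ck_ext _ _ (F * partial a G + G * partial a F)) => //.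
  by move=> x Vx; rewrite /partial deriveM//; [exact: f1|exact: g1].
by apply: is_CkD => //; apply: IH => //; exact: is_Ck_pred.
Qed.

(** The induction on [k] runs over all polynomials at once, since differentiating changes [P]. *)
Lemma is_Ck_flat k V F P : open V -> is_Ck k V F -> is_Ck k V (flat P \o F).
Proof.
move=> oV; elim: k F P => [|k IH] F P CF.
  have [cF _] := CF; split=> // x Vx.
  by apply: continuous_comp; [exact: cF|exact: continuous_flat].
have [cF dF] := CF; split=> [x Vx|a].
  by apply: continuous_comp; [exact: cF|exact: continuous_flat].
have [f1 f2] := dF a; split=> [x Vx|].
  by have [] := is_derive_comp (is_derive_flat P (F x)) (f1 x Vx).
apply: (@is_Ck_ext _ _ ((flat ('X^2 * (P - P^`())) \o F) * partial a F)) => //.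
  move=> x Vx; rewrite /partial.
  by have [_ ->] := is_derive_comp (is_derive_flat P (F x)) (f1 x Vx).
by apply: is_CkM => //; apply: IH; exact: is_Ck_pred.
Qed.

End Ck.

(** * Positive definite matrices *)

Section PosDef.
Variables (R : realType) (n : nat).
Implicit Types (g h : 'M[R]_n) (a b v : 'rV[R]_n).

Definition posdef g := forall v, v != 0 -> 0 < (v *m g *m v^T) 0 0.
(* The inner product induced by the metric g on covectors. *)
Definition qform g a b : R := (a *m invmx g *m b^T) 0 0.

Lemma posdef_unit g : posdef g -> g \in unitmx.
Proof.
move=> pg; rewrite -row_free_unit -kermx_eq0; apply/eqP/row_matrixP => i.
rewrite row0; apply: contrapT => /eqP /pg.
by rewrite -row_mul mulmx_ker row0 mul0mx mxE ltxx.
Qed.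

(** The segment t g + (1 - t) I consists of positive definite, hence invertible, matrices. Its
    determinant [q] is a polynomial in t equal to 1 at 0 and without zeros on [0, 1], so it is
    positive at 1 by the intermediate value theorem. *)
Lemma posdef_det_gt0 g : posdef g -> 0 < \det g.
Proof.
move=> pg.
pose q : {poly R} := \det (('X)%:M *m map_mx polyC g + (1 - 'X)%:M).
have qE t : q.[t] = \det (t *: g + (1 - t)%:M).
  rewrite /q -[LHS]/(horner_eval t _) -det_map_mx; congr (\det _).
  rewrite map_mxD map_mxM !map_scalar_mx /= /horner_eval !hornerE -map_mx_comp.
  rewrite mul_scalar_mx; congr (_ *: _ + _).
  by apply/matrixP => i j; rewrite !mxE /= /horner_eval hornerC.
have q0 t : 0 <= t -> t <= 1 -> q.[t] != 0.
  move=> t0 t1; rewrite qE -unitfE -unitmxE; apply: posdef_unit => v v0.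
  have vv : 0 < (v *m v^T) 0 0.
    rewrite mxE lt_neqAle sumr_ge0 ?andbT; last by move=> i _; rewrite mxE -expr2 sqr_ge0.
    apply: contra v0; rewrite eq_sym psumr_eq0; last by move=> i _; rewrite mxE -expr2 sqr_ge0.
    move=> /allP H; apply/eqP/rowP => i; have := H i (mem_index_enum _).
    by rewrite !mxE -expr2 sqrf_eq0 => /eqP.
  rewrite mulmxDr mulmxDl -scalemxAr -scalemxAl mul_mx_scalar -scalemxAl.
  rewrite mxE [X in X + _]mxE [X in _ + X]mxE.
  have := pg v v0; set x := _ 0 0; move: vv; set y := _ 0 0 => y0 x0.
  have [->|t00] := eqVneq t 0; first by rewrite mul0r add0r subr0 mul1r.
  apply: ltr_pwDl; first by rewrite mulr_gt0// lt_neqAle eq_sym t00.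
  by apply: mulr_ge0; [rewrite subr_ge0|exact: ltW].
have q00 : q.[0] = 1 by rewrite qE scale0r add0r subr0 det1.
have q1 : q.[1] = \det g by rewrite qE scale1r subrr raddf0 addr0.
rewrite -q1 ltNge; apply/negP => q1le.
have [|t] := @poly_ivt _ (- q) 0 1 ler01.
  by rewrite !hornerN q00 oppr_ge0 q1le oppr_le0 ler01.
move=> /andP[t0 t1]; rewrite rootN => /rootP /eqP.
by rewrite (negbTE (q0 t t0 t1)).
Qed.

Lemma qformDl g a a' b : qform g (a + a') b = qform g a b + qform g a' b.
Proof. by rewrite /qform !mulmxDl mxE. Qed.

Lemma qformDr g a b b' : qform g a (b + b') = qform g a b + qform g a b'.
Proof. by rewrite /qform linearD mulmxDr mxE. Qed.

Lemma qformZl g k a b : qform g (k *: a) b = k * qform g a b.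
Proof. by rewrite /qform -!scalemxAl mxE. Qed.

Lemma qformZr g k a b : qform g a (k *: b) = k * qform g a b.
Proof. by rewrite /qform linearZ -scalemxAr mxE. Qed.

Lemma qformNl g a b : qform g (- a) b = - qform g a b.
Proof. by rewrite -scaleN1r qformZl mulN1r. Qed.

Lemma qformNr g a b : qform g a (- b) = - qform g a b.
Proof. by rewrite -scaleN1r qformZr mulN1r. Qed.

Lemma qform0l g b : qform g 0 b = 0.
Proof. by rewrite /qform !mul0mx mxE. Qed.

Lemma qform0r g a : qform g a 0 = 0.
Proof. by rewrite /qform trmx0 mulmx0 mxE. Qed.

Section Fixed.
Variable g : 'M[R]_n.
Hypotheses (sg : g^T = g) (pg : posdef g).

Lemma qformC a b : qform g a b = qform g b a.
Proof.
rewrite /qform.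
have -> : a *m invmx g *m b^T = (b *m invmx g *m a^T)^T.
  by rewrite !trmx_mul trmxK trmx_inv sg mulmxA.
by rewrite mxE.
Qed.

Lemma qform_ge0 a : 0 <= qform g a a.
Proof.
(* Raising the index of [a] turns the dual form into the quadratic form of [g] itself. *)
have ug := posdef_unit pg.
pose v := a *m invmx g.
have -> : qform g a a = (v *m g *m v^T) 0 0.
  by rewrite /v /qform mulmxKV// trmx_mul trmx_inv sg mulmxA.
have [->|/pg/ltW//] := eqVneq v 0.
by rewrite !mul0mx mxE.
Qed.

Lemma qformD_le a b : qform g (a + b) (a + b) <= 2 * qform g a a + 2 * qform g b b.
Proof.
have := qform_ge0 (a - b).
rewrite !(qformDl, qformDr, qformNl, qformNr) (qformC b a); lra.
Qed.

Lemma qform_abs_le a b : `|qform g a b| <= qform g a a + qform g b b.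
Proof.
have := qform_ge0 (a - b); have := qform_ge0 (a + b).
have := qform_ge0 a; have := qform_ge0 b.
rewrite !(qformDl, qformDr, qformNl, qformNr) (qformC b a) => *.
by rewrite ler_norml; apply/andP; split; lra.
Qed.

Lemma qform_coord_le a (c : 'I_n) : a 0 c ^+ 2 <= qform g a a * g c c.
Proof.
have ug := posdef_unit pg.
pose e : 'rV[R]_n := delta_mx 0 c.
have ege (x : 'rV[R]_n) : qform g x (e *m g) = x 0 c.
  rewrite /qform trmx_mul sg !mulmxA mulmxKV// /e trmx_delta -[delta_mx c 0]/(_).
  rewrite !mxE (bigD1 c)//= mxE !eqxx mulr1 big1 ?addr0// => j jc.
  by rewrite mxE (negbTE jc) mulr0.
have gc : 0 < g c c.
  have e0 : e != 0.
    apply/eqP => /rowP /(_ c)/eqP; rewrite !mxE !eqxx /=.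
    by rewrite oner_eq0.
  by have := pg e0; rewrite -rowE mxE (bigD1 c)//= !mxE !eqxx mulr1 big1 ?addr0// => j jc;
    rewrite !mxE (negbTE jc) andbF mulr0.
have eg : (e *m g) 0 c = g c c by rewrite -rowE mxE.
have := qform_ge0 (a - (a 0 c / g c c) *: (e *m g)).
rewrite !(qformDl, qformDr, qformNl, qformNr, qformZl, qformZr) (qformC _ a) !ege eg.
rewrite divfK ?gt_eqF//.
set s := a 0 c => H; rewrite -ler_pdivrMr//.
rewrite expr2 mulrAC; lra.
Qed.

(** Expand the left side and bound each product of coordinates by their squares, then by
    [qform_coord_le]. The constant is explicit so that it varies continuously with both metrics. *)
Lemma qform_compare h a :
  qform h a a <= (\sum_i \sum_j `|invmx h i j| * (g i i + g j j)) * qform g a a.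
Proof.
set q := qform g a a; rewrite mulr_suml; under [leRHS]eq_bigr do rewrite mulr_suml.
rewrite [leRHS]exchange_big /qform mxE /=; apply: ler_sum => j _.
rewrite mxE mulr_suml; apply: ler_sum => i _.
rewrite mxE; apply: le_trans (ler_norm _) _; rewrite !normrM.
rewrite mulrAC mulrC -mulrA ler_wpM2l//.
have := qform_coord_le a i; have := qform_coord_le a j; rewrite -/q.
have := sqr_ge0 (`|a 0 i| - `|a 0 j|); rewrite sqrrB !real_normK ?num_real//.
have := sqr_ge0 (a 0 i); have := sqr_ge0 (a 0 j).
by rewrite mulrDl ![_ * q]mulrC; lra.
Qed.

End Fixed.
End PosDef.

(** * Measurability in charts *)

Section ChartMeasurability.
Variables (R : realType) (m : nat) (T : topologicalType).
Variable M : compact_manifold R m T.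
Local Notation n := m.+1.
Local Notation chart := 'I_(charts M).
Local Notation mR := (measurableTypeR R).
Local Notation tup := (n.-tuple mR).
Implicit Types (i j : chart) (U S Om K : set T) (p : T).

Definition chart_set i S : set 'rV[R]_n := phi i @` dom i `&` psi i @^-1` S.

Lemma chart_setE i S : phi i @` (dom i `&` S) = chart_set i S.
Proof.
apply/seteqP; split => [x [p [dp Sp] <-]|x [[p dp <-]]].
  by split; [exists p|rewrite /= phiK].
by rewrite /= phiK// => Sp; exists p.
Qed.

Lemma chart_set_open i U : open U ->
  exists2 V, open V & chart_set i U = phi i @` dom i `&` V.
Proof.
move=> oU; apply: cwithin_preimage => //; apply/subspace_continuousP.
exact: psi_continuous.
Qed.

Lemma open_coord0 (U : set R) : open U -> open [set x : 'rV[R]_n | U (x 0 0)].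
Proof.
move=> oU; apply: (@open_comp _ _ (fun x : 'rV[R]_n => x 0 0)) => // x _.
exact: coord_continuous.
Qed.

Lemma measurable_chart i : measurable (@vec R n @^-1` (phi i @` dom i)).
Proof.
have [V oV ->] := phi_image i; apply: (measurableI (@vec R n @^-1` V)).
  exact: measurable_vec_open.
have : measurable (@vec R n @^-1` [set x | x 0 0 < 0]).
  by apply: measurable_vec_open; exact: (open_coord0 (@open_lt R 0)).
move=> /measurableC; congr measurable; apply/seteqP.
by split=> t /=; rewrite /half_space /= leNgt => /negP.
Qed.

(** [T] carries no sigma-algebra, so measurability of a subset is tested in every chart. *)
Definition measurable_region S := forall i, measurable (@vec R n @^-1` chart_set i S).

Lemma measurable_region_open U : open U -> measurable_region U.
Proof.
move=> oU i; have [V oV ->] := chart_set_open i oU.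
by apply: (measurableI _ _ (measurable_chart i)); exact: measurable_vec_open.
Qed.

Lemma measurable_regionC S : measurable_region S -> measurable_region (~` S).
Proof.
move=> mS i; rewrite (_ : _ @^-1` _ =
  (@vec R n @^-1` (phi i @` dom i)) `\` (@vec R n @^-1` chart_set i S)).
  by apply: measurableD => //; exact: measurable_chart.
by apply/seteqP; split => t [At]; [move=> nS; split=> // -[]|move=> nS; split=> // /(conj At)].
Qed.

Lemma measurable_regionI S S' :
  measurable_region S -> measurable_region S' -> measurable_region (S `&` S').
Proof.
move=> mS mS' i; have := measurableI _ _ (mS i) (mS' i); congr measurable.
by apply/seteqP; split => t; [move=> [[? ?] [? ?]]|move=> [? [? ?]]].
Qed.

Lemma measurable_region_bigcap (F : chart -> set T) (P : set chart) :
  (forall j, measurable_region (F j)) -> measurable_region (\bigcap_(j in P) F j).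
Proof.
move=> mF i; rewrite (_ : _ @^-1` _ = (@vec R n @^-1` (phi i @` dom i)) `&`
    (\bigcap_(j in P) @vec R n @^-1` chart_set i (F j))).
  apply: measurableI; first exact: measurable_chart.
  by apply: fin_bigcap_measurable => [|j _]; [exact: finite_finset|exact: mF].
apply/seteqP; split => t [At H]; split=> // j Pj; first by split=> //; exact: H.
by have [] := H j Pj.
Qed.

Lemma measurable_region_interior : measurable_region (manifold_interior M).
Proof.
(* The condition at chart [j] is an implication from [dom j p], hence the double complement; the
   points of [dom j] with positive first coordinate form an open set. *)
have -> : manifold_interior M = \bigcap_(j in [set: chart])
    ~` (dom j `&` ~` [set p | dom j p /\ 0 < phi j p 0 0]).
  apply/seteqP; split=> [p ip j _ [dj H]|p H j dj].
    by apply: H; split=> //; exact: ip.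
  by apply: contrapT => H'; apply: (H j I); split => // -[].
apply: measurable_region_bigcap => j; apply: measurable_regionC.
apply: measurable_regionI; first by apply: measurable_region_open; exact: dom_open.
apply: measurable_regionC; apply: measurable_region_open.
rewrite openE => p [dp pos].
have /subspace_continuousP/(_ p dp) cp := @phi_continuous _ _ _ M j.
have posn : nbhs (phi j p) [set x | 0 < x 0 0].
  by apply: open_nbhs_nbhs; split=> //; exact: (open_coord0 (@open_gt R 0)).
have cn : nbhs p [set q | dom j q -> 0 < phi j q 0 0] := cp _ posn.
have dn : nbhs p (dom j) := open_nbhs_nbhs (conj (@dom_open _ _ _ M j) dp).
rewrite /interior; near=> q.
have dq : dom j q by near: q.
by split=> //; move: dq; near: q.
Unshelve. all: by end_near.
Qed.

Lemma measurable_piece Om i : measurable_region Om -> measurable (piece Om i).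
Proof.
move=> mO; rewrite (_ : piece Om i = @vec R n @^-1` chart_set i
    (Om `&` \bigcap_(j in [set j : chart | (j < i)%N]) ~` dom j)).
  apply: measurable_regionI => //; apply: measurable_region_bigcap => j.
  apply: measurable_regionC; apply: measurable_region_open; exact: dom_open.
by apply/seteqP; split=> t; [move=> [? [? H]]|move=> [? [? H]]].
Qed.

(** A chart image is an open set cut by the half-space; at an interior point the first coordinate is
    positive, so the cut is not felt nearby. *)
Lemma chart_nbhs U i p : open U -> U p -> dom i p -> manifold_interior M p ->
  nbhs (phi i p) (chart_set i U).
Proof.
move=> oU Up dp ip; have [V oV VE] := chart_set_open i oU.
have [W oW WE] := phi_image i.
have ipos : 0 < phi i p 0 0 by exact: ip.
apply: (@filterS _ _ _ (W `&` V `&` [set x : 'rV[R]_n | 0 < x 0 0])).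
  move=> x [[Wx Vx] x0]; rewrite VE; split=> //; rewrite WE; split=> //.
  exact: ltW.
apply: open_nbhs_nbhs; split.
  by apply: openI; [exact: openI|exact: (open_coord0 (@open_gt R 0))].
have : chart_set i U (phi i p) by split; [exists p|rewrite /= phiK].
rewrite VE => -[[q dq qp] Vp]; split=> //; split=> //.
have : (phi i @` dom i) (phi i p) by exists p.
by rewrite WE => -[].
Qed.

End ChartMeasurability.

(** * Algebra of relatively continuous functions *)

Section CwithinAlgebra.
Variables (R : realType) (n : nat) (A : set 'rV[R]_n).
Implicit Types F G : 'rV[R]_n -> R.

Lemma cwithin_cst (c : R) : cwithin A (fun=> c).
Proof. by move=> x _; exact: cvg_cst. Qed.

Lemma cwithinD F G : cwithin A F -> cwithin A G -> cwithin A (fun x => F x + G x).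
Proof. by move=> cF cG x Ax; apply: cvgD; [exact: cF|exact: cG]. Qed.

Lemma cwithinM F G : cwithin A F -> cwithin A G -> cwithin A (fun x => F x * G x).
Proof. by move=> cF cG x Ax; apply: cvgM; [exact: cF|exact: cG]. Qed.

Lemma cwithinV F : (forall x, A x -> F x != 0) -> cwithin A F ->
  cwithin A (fun x => (F x)^-1).
Proof. by move=> F0 cF x Ax; apply: cvgV; [exact: F0|exact: cF]. Qed.

Lemma cwithin_comp F (f : R -> R) : continuous f -> cwithin A F -> cwithin A (f \o F).
Proof. by move=> cf cF x Ax; apply: cvg_comp (cF x Ax) (cf _). Qed.

Lemma cwithin_eq F G : {in A, F =1 G} -> cwithin A F -> cwithin A G.
Proof.
move=> FG cF x Ax; rewrite -FG ?inE//; apply: cvg_trans (cF x Ax).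
apply: near_eq_cvg; rewrite near_withinE; apply: nearW => y Ay.
by rewrite FG ?inE.
Qed.

Lemma cwithin_sum I (r : seq I) (P : pred I) (F : I -> 'rV[R]_n -> R) :
  (forall i, P i -> cwithin A (F i)) -> cwithin A (fun x => \sum_(i <- r | P i) F i x).
Proof.
move=> cF; elim: r => [|i r IH].
  by under eq_fun do rewrite big_nil; exact: cwithin_cst.
under eq_fun do rewrite big_cons.
case: (P i) (cF i) => // cFi; apply: cwithinD => //; exact: cFi.
Qed.

Lemma cwithin_prod I (r : seq I) (P : pred I) (F : I -> 'rV[R]_n -> R) :
  (forall i, P i -> cwithin A (F i)) -> cwithin A (fun x => \prod_(i <- r | P i) F i x).
Proof.
move=> cF; elim: r => [|i r IH].
  by under eq_fun do rewrite big_nil; exact: cwithin_cst.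
under eq_fun do rewrite big_cons.
case: (P i) (cF i) => // cFi; apply: cwithinM => //; exact: cFi.
Qed.

Lemma cwithin_det k (F : 'rV[R]_n -> 'M[R]_k) :
  (forall i j, cwithin A (fun x => F x i j)) -> cwithin A (fun x => \det (F x)).
Proof.
move=> cF; apply: cwithin_sum => s _; apply: cwithinM; first exact: cwithin_cst.
by apply: cwithin_prod => i _; exact: cF.
Qed.

Lemma cwithin_invmx k (F : 'rV[R]_n -> 'M[R]_k) :
  (forall x, A x -> F x \in unitmx) ->
  (forall i j, cwithin A (fun x => F x i j)) ->
  forall i j, cwithin A (fun x => invmx (F x) i j).
Proof.
move=> uF cF i j.
(* The cofactor formula expresses the inverse through determinants, which are polynomial in the
   entries. *)
apply: (@cwithin_eq (fun x => (\det (F x))^-1 * ((-1) ^+ (j + i) *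
   \det (row' j (col' i (F x)))))).
  by move=> x /set_mem Ax; rewrite /invmx uF// !mxE.
apply: cwithinM.
  apply: cwithinV; last exact: cwithin_det.
  by move=> x /uF; rewrite unitmxE unitfE.
apply: cwithinM; first exact: cwithin_cst.
apply: cwithin_det => a b.
by under eq_fun do rewrite !mxE; exact: cF.
Qed.

End CwithinAlgebra.

(** * Continuity and measurability of metric quantities *)

Section Metric.
Variables (R : realType) (m : nat) (T : topologicalType).
Variable M : compact_manifold R m T.
Local Notation n := m.+1.
Local Notation chart := 'I_(charts M).
Local Notation mR := (measurableTypeR R).
Local Notation tup := (n.-tuple mR).
Implicit Types (i j : chart) (U S Om K : set T) (p : T) (g : tensor M).

Lemma innerE g i x a b : inner g i x a b = qform (g i x) a b.
Proof. by []. Qed.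

Lemma riemannian_sym g i x : riemannian g -> (phi i @` dom i) x -> (g i x)^T = g i x.
Proof. by move=> [_ H _ _] [p dp <-]; exact: H. Qed.

Lemma riemannian_posdef g i x : riemannian g -> (phi i @` dom i) x -> posdef (g i x).
Proof. by move=> [_ _ H _] [p dp <-] v; exact: H. Qed.

Lemma riemannian_cwithin g i a b : riemannian g ->
  cwithin (phi i @` dom i) (fun x => g i x a b).
Proof. by move=> [H _ _ _]; apply: smooth_on_cwithin; exact: H. Qed.

Lemma riemannian_cwithin_inv g i a b : riemannian g ->
  cwithin (phi i @` dom i) (fun x => invmx (g i x) a b).
Proof.
move=> rg; apply: cwithin_invmx => [x Ax|a' b'].
  by apply: posdef_unit; exact: riemannian_posdef.
exact: riemannian_cwithin.
Qed.

Definition density g i x := Num.sqrt (\det (g i x)).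

Lemma riemannian_cwithin_density g i : riemannian g ->
  cwithin (phi i @` dom i) (density g i).
Proof.
move=> rg; apply: (@cwithin_comp _ _ _ (fun x => \det (g i x)) (@Num.sqrt R)).
  exact: sqrt_continuous.
by apply: cwithin_det => a b; exact: riemannian_cwithin.
Qed.

Definition piece_fun (F : chart -> 'rV[R]_n -> R) Om :=
  forall i, measurable_fun (piece Om i) (fun t : tup => F i (vec t)).

Lemma piece_sub_chart Om i : piece Om i `<=` @vec R n @^-1` (phi i @` dom i).
Proof. by move=> t []. Qed.

Lemma cwithin_piece_fun (F : chart -> 'rV[R]_n -> R) Om :
  (forall i, cwithin (phi i @` dom i) (F i)) -> piece_fun F Om.
Proof.
move=> cF i; apply: (measurable_funS (measurable_chart i) (@piece_sub_chart Om i)).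
by apply: measurable_cwithin => //; exact: measurable_chart.
Qed.


Definition mfield (u : fun_diff M) Om :=
  piece_fun (fun i x => u.1 (psi i x)) Om /\ (forall a, piece_fun (fun i x => u.2 i x 0 a) Om).

Lemma measurable_piece_inner g (u v : fun_diff M) Om : riemannian g ->
  mfield u Om -> mfield v Om ->
  piece_fun (fun i x => inner g i x (u.2 i x) (v.2 i x)) Om.
Proof.
move=> rg [_ mu] [_ mv] i.
under eq_fun => t do rewrite innerE /qform mxE.
apply: measurable_sum => b; apply: measurable_funM.
  under eq_fun => t do rewrite mxE.
  apply: measurable_sum => a; apply: measurable_funM; first exact: mu.
  by apply: (@cwithin_piece_fun (fun i x => invmx (g i x) a b)) => j; exact: riemannian_cwithin_inv.
by under eq_fun => t do rewrite mxE; exact: mv.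
Qed.

Lemma measurable_piece_density g Om : riemannian g -> piece_fun (density g) Om.
Proof. by move=> rg; apply: cwithin_piece_fun => i; exact: riemannian_cwithin_density. Qed.

End Metric.

(** * Integration against the Riemannian volume *)

Definition tuple_measure (R : realType) n :
    {sigma_finite_measure set (n.-tuple (measurableTypeR R)) -> \bar R} :=
  projT1 (cid (lebesgue_tuple_sigma_finite R n)).

Lemma tuple_measureE (R : realType) n :
  @lebesgue_tuple R n = tuple_measure R n :> (set _ -> \bar R).
Proof. by rewrite /tuple_measure; case: cid. Qed.

Section IntegralVol.
Variables (R : realType) (m : nat) (T : topologicalType).
Variable M : compact_manifold R m T.
Local Notation n := m.+1.
Local Notation chart := 'I_(charts M).
Local Notation mR := (measurableTypeR R).
Local Notation tup := (n.-tuple mR).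
Local Notation mu := (tuple_measure R n).
Implicit Types (i j : chart) (U S Om K : set T) (p : T) (g : tensor M).
Implicit Types F : chart -> 'rV[R]_n -> R.

Lemma integral_volE g Om F : integral_vol g Om F =
  (\sum_(i : chart) \int[mu]_(t in piece Om i) (F i (vec t) * density g i (vec t))%:E)%E.
Proof. by rewrite -tuple_measureE. Qed.

Lemma density_ge0 g i x : 0 <= density g i x.
Proof. exact: sqrtr_ge0. Qed.

Lemma measurable_density_mul g Om F i : riemannian g -> piece_fun F Om ->
  measurable_fun (piece Om i) (fun t => (F i (vec t) * density g i (vec t))%:E).
Proof.
move=> rg mF; apply/measurable_EFinP; apply: measurable_funM; first exact: mF.
exact: measurable_piece_density.
Qed.

Lemma integral_vol_ge0 g Om F : (forall i t, piece Om i t -> 0 <= F i (vec t)) ->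
  (0 <= integral_vol g Om F)%E.
Proof.
move=> F0; rewrite integral_volE; apply: sume_ge0 => i _.
by apply: integral_ge0 => t /F0 Ft; rewrite lee_fin mulr_ge0// density_ge0.
Qed.

(** The densities are part of the hypothesis, so that integrals for two different metrics can be
    compared; [le_integral_vol] has the same form. *)
Lemma eq_integral_vol g g' Om F F' :
  (forall i t, piece Om i t ->
     F i (vec t) * density g i (vec t) = F' i (vec t) * density g' i (vec t)) ->
  integral_vol g Om F = integral_vol g' Om F'.
Proof.
move=> FF'; rewrite !integral_volE; apply: eq_bigr => i _.
by apply: eq_integral => t /set_mem pt; rewrite FF'.
Qed.

Lemma le_integral_vol g g' Om F F' : riemannian g -> riemannian g' -> measurable_region M Om ->
  piece_fun F Om -> piece_fun F' Om ->
  (forall i t, piece Om i t -> 0 <= F i (vec t)) ->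
  (forall i t, piece Om i t ->
     F i (vec t) * density g i (vec t) <= F' i (vec t) * density g' i (vec t)) ->
  (integral_vol g Om F <= integral_vol g' Om F')%E.
Proof.
move=> rg rg' mO mF mF' F0 FF'; rewrite !integral_volE; apply: lee_sum => i _.
apply: ge0_le_integral.
- exact: measurable_piece.
- by move=> t /F0 Ft; rewrite lee_fin mulr_ge0// density_ge0.
- exact: measurable_density_mul.
- exact: measurable_density_mul.
- by move=> t pt; rewrite lee_fin; exact: FF'.
Qed.

Lemma integral_volZ g Om F (c : R) : riemannian g -> measurable_region M Om ->
  piece_fun F Om -> 0 <= c -> (forall i t, piece Om i t -> 0 <= F i (vec t)) ->
  integral_vol g Om (fun i x => c * F i x) = (c%:E * integral_vol g Om F)%E.
Proof.
move=> rg mO mF c0 F0; rewrite !integral_volE ge0_sume_distrr; last first.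
  move=> i _; apply: integral_ge0 => t /F0 Ft.
  by rewrite lee_fin mulr_ge0// density_ge0.
apply: eq_bigr => i _; rewrite -ge0_integralZl_EFin//.
- by apply: eq_integral => t _; rewrite -EFinM mulrA.
- exact: measurable_piece.
- by move=> t /F0 Ft; rewrite lee_fin mulr_ge0// density_ge0.
- exact: measurable_density_mul.
Qed.

Lemma integral_volD g Om F F' : riemannian g -> measurable_region M Om ->
  piece_fun F Om -> piece_fun F' Om ->
  (forall i t, piece Om i t -> 0 <= F i (vec t)) ->
  (forall i t, piece Om i t -> 0 <= F' i (vec t)) ->
  integral_vol g Om (fun i x => F i x + F' i x) =
  (integral_vol g Om F + integral_vol g Om F')%E.
Proof.
move=> rg mO mF mF' F0 F0'; rewrite !integral_volE -big_split; apply: eq_bigr => i _ /=.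
rewrite -ge0_integralD.
- by apply: eq_integral => t _; rewrite -EFinD mulrDl.
- exact: measurable_piece.
- by move=> t /F0 Ft; rewrite lee_fin mulr_ge0// density_ge0.
- exact: measurable_density_mul.
- by move=> t /F0' Ft; rewrite lee_fin mulr_ge0// density_ge0.
- exact: measurable_density_mul.
Qed.

(** The rule assigning a point to its first chart does not depend on the region, so the pieces of
    [Om] are those of [Om'] restricted to [Om]. *)
Lemma integral_vol_support g Om Om' F : Om `<=` Om' ->
  (forall i t, piece Om' i t -> ~ Om (psi i (vec t)) -> F i (vec t) = 0) ->
  integral_vol g Om' F = integral_vol g Om F.
Proof.
move=> OO' F0; rewrite !integral_volE; apply: eq_bigr => i _.
rewrite integral_mkcond [RHS]integral_mkcond; apply: eq_integral => t _.
rewrite /patch; case: ifPn => [/set_mem pt'|nt']; case: ifPn => [/set_mem pt|nt] //.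
- rewrite F0 ?mul0r// => Ot; move/negP: nt; apply; apply/mem_set.
  by case: pt' => At [_ H]; split.
- move/negP: nt' => []; apply/mem_set.
  by case: pt => At [Ot H]; split=> //; split=> //; exact: OO'.
Qed.

Lemma piece_sub Om Om' i : Om `<=` Om' -> piece Om i `<=` piece Om' i.
Proof. by move=> OO' t [At [Ot H]]; split=> //; split=> //; exact: OO'. Qed.

Lemma piece_funS Om Om' F : measurable_region M Om' -> Om `<=` Om' ->
  piece_fun F Om' -> piece_fun F Om.
Proof.
move=> mO' OO' mF i; apply: measurable_funS (mF i); first exact: measurable_piece.
exact: piece_sub.
Qed.

Lemma subset_integral_vol g Om Om' F : riemannian g ->
  measurable_region M Om -> measurable_region M Om' -> Om `<=` Om' ->
  piece_fun F Om' -> (forall i t, piece Om' i t -> 0 <= F i (vec t)) ->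
  (integral_vol g Om F <= integral_vol g Om' F)%E.
Proof.
move=> rg mO mO' OO' mF F0; rewrite !integral_volE; apply: lee_sum => i _.
apply: ge0_subset_integral; [exact: measurable_piece|exact: measurable_piece| | |].
- exact: measurable_density_mul.
- by move=> t /F0 Ft; rewrite lee_fin mulr_ge0// density_ge0.
- exact: piece_sub.
Qed.

Definition integrable_vol g Om F := forall i,
  mu.-integrable (piece Om i) (fun t => (F i (vec t) * density g i (vec t))%:E).

Lemma integrable_volP g Om F F' : riemannian g -> measurable_region M Om ->
  piece_fun F Om -> piece_fun F' Om ->
  (forall i t, piece Om i t -> `|F i (vec t)| <= F' i (vec t)) ->
  (integral_vol g Om F' < +oo)%E -> integrable_vol g Om F.
Proof.
move=> rg mO mF mF' FF'; rewrite integral_volE => foo i; apply/integrableP; split.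
  exact: measurable_density_mul.
(* All terms of the sum over charts are nonnegative, so a finite total bounds each of them. *)
apply: le_lt_trans foo; rewrite (bigD1 i)//=.
apply: (@le_trans _ _ (\int[mu]_(t in piece Om i) (F' i (vec t) * density g i (vec t))%:E)%E).
  apply: ge0_le_integral => //; first exact: measurable_piece.
  - apply/measurable_EFinP; apply: measurableT_comp => //.
    by apply/measurable_EFinP; exact: measurable_density_mul.
  - exact: measurable_density_mul.
  - move=> t pt; rewrite lee_fin normrM (ger0_norm (density_ge0 _ _ _)).
    by rewrite ler_wpM2r ?density_ge0// FF'.
apply: leeDl; apply: sume_ge0 => j _; apply: integral_ge0 => t pt.
rewrite lee_fin mulr_ge0 ?density_ge0//.
exact: le_trans (normr_ge0 _) (FF' _ _ pt).
Qed.

Lemma integrable_vol_fin_num g Om F : measurable_region M Om -> integrable_vol g Om F ->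
  integral_vol g Om F \is a fin_num.
Proof.
move=> mO iF; rewrite integral_volE; apply/sum_fin_numP => i _ _.
by apply: integrable_fin_num => //; exact: measurable_piece.
Qed.

Lemma integrable_integral_volB g Om F F' : measurable_region M Om ->
  integrable_vol g Om F -> integrable_vol g Om F' ->
  integral_vol g Om (fun i x => F i x - F' i x) =
  (integral_vol g Om F - integral_vol g Om F')%E.
Proof.
move=> mO iF iF'.
rewrite !integral_volE -sumeN; last first.
  move=> i j _ _; apply: fin_num_adde_defl; apply: integrable_fin_num => //.
  exact: measurable_piece.
rewrite -big_split; apply: eq_bigr => i _ /=.
rewrite -integralB//; last exact: measurable_piece.
by apply: eq_integral => t _; rewrite /= -EFinB mulrBl.
Qed.

Lemma integral_vol_split g Om Om' F : measurable_region M Om -> measurable_region M Om' ->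
  Om `<=` Om' -> integrable_vol g Om' F ->
  integral_vol g Om' F = (integral_vol g Om F + integral_vol g (Om' `\` Om) F)%E.
Proof.
move=> mO mO' OO' iF; rewrite !integral_volE -big_split; apply: eq_bigr => i _ /=.
rewrite -integral_setU.
- congr integral; apply/seteqP; split=> t.
    move=> [At [Ot H]]; have [inO|ninO] := pselect (Om (psi i (vec t))).
      by left.
    by right.
  by move=> [[At [Ot H]]|[At [[Ot _] H]]]; split=> //; split=> //; exact: OO'.
- exact: measurable_piece.
- apply: measurable_piece; rewrite setDE; apply: measurable_regionI => //.
  exact: measurable_regionC.
- apply: measurable_funS (measurable_int _ (iF i)); first exact: measurable_piece.
  by move=> t [|]; apply: piece_sub => // p [].
- by apply/disj_setPS => t [[_ [Ot _]] [_ [[_ ?] _]]].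
Qed.

End IntegralVol.

(** * Change of chart and comparison of Riemannian metrics *)

Section Congruence.
Variables (R : realType) (n : nat).
Implicit Types (g J : 'M[R]_n) (a b : 'rV[R]_n).

Lemma invmx_congr g J : J \in unitmx -> g \in unitmx ->
  invmx (J *m g *m J^T) = invmx J^T *m invmx g *m invmx J.
Proof.
move=> uJ ug; have uJt : J^T \in unitmx by rewrite unitmx_tr.
have uC : J *m g *m J^T \in unitmx by rewrite !unitmx_mul uJ ug.
apply: (can_inj (mulKmx uC)); rewrite mulmxV// !mulmxA.
by rewrite mulmxK// mulmxK// mulmxV.
Qed.

(** If tangent vectors transform by [J], covectors transform by the inverse transpose. *)
Lemma qform_congr g J a : J \in unitmx -> g \in unitmx ->
  qform (J *m g *m J^T) a a = qform g (a *m invmx J^T) (a *m invmx J^T).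
Proof.
move=> uJ ug; rewrite /qform invmx_congr// trmx_mul trmx_inv trmxK.
by rewrite !mulmxA.
Qed.

Lemma sqrt_det_congr g J :
  Num.sqrt (\det (J *m g *m J^T)) = `|\det J| * Num.sqrt (\det g).
Proof.
by rewrite !det_mulmx det_tr mulrAC -expr2 sqrtrM ?sqr_ge0// sqrtr_sqr.
Qed.
End Congruence.

Section MetricComparison.
Variables (R : realType) (m : nat) (T : topologicalType).
Variable M : compact_manifold R m T.
Local Notation n := m.+1.
Local Notation chart := 'I_(charts M).
Variables (g g0 : tensor M).
Hypotheses (rg : riemannian g) (rg0 : riemannian g0).

(** These two inequalities bound the two terms of the H^1 integrand, weighted by the volume
    density. *)
Let comparable_at (C : R) (i : chart) p :=
  density g i (phi i p) <= C * density g0 i (phi i p) /\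
  forall a, qform (g i (phi i p)) a a * density g i (phi i p) <=
    C * (qform (g0 i (phi i p)) a a * density g0 i (phi i p)).

Let chart_image (i : chart) p : dom i p -> (phi i @` dom i) (phi i p).
Proof. by move=> dp; exists p. Qed.

(** Passing from chart [j] to chart [i] multiplies both sides by the same |det J| and replaces the
    covector, over which the second inequality is quantified; so the constant is kept. *)
Let comparable_change C i j p : dom i p -> dom j p -> manifold_interior M p ->
  comparable_at C j p -> comparable_at C i p.
Proof.
move=> di dj ip [c1 c2].
have [_ _ _ /(_ i j p di dj ip) gE] := rg.
have [_ _ _ /(_ i j p di dj ip) g0E] := rg0.
have ugj := posdef_unit (riemannian_posdef rg (chart_image dj)).
have ug0j := posdef_unit (riemannian_posdef rg0 (chart_image dj)).
have := posdef_unit (riemannian_posdef rg (chart_image di)).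
move: gE g0E; set J := Defs.jacobian i j _ => gE g0E.
rewrite gE !unitmx_mul => /andP[/andP[uJ _] _].
rewrite /comparable_at /density gE g0E !sqrt_det_congr; split.
  by rewrite mulrCA ler_wpM2l.
move=> a; rewrite !qform_congr//.
have := ler_wpM2l (normr_ge0 (\det J)) (c2 (a *m invmx J^T)); rewrite /density.
by congr (_ <= _); ring.
Qed.

Let local_comparable (q : T) : exists C, \forall p \near q,
  forall i, dom i p -> manifold_interior M p -> comparable_at C i p.
Proof.
have [j dq] := dom_cover M q.
pose K x := \sum_a \sum_b `|invmx (g j x) a b| * (g0 j x a a + g0 j x b b).
(* The factor 1 + K^2 dominates both 1 and K, so a single continuous function serves for both
   inequalities. *)
pose L x := density g j x / density g0 j x * (1 + K x * K x).
have d0 x : (phi j @` dom j) x -> density g0 j x != 0.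
  move=> Ax; rewrite /density gt_eqF// sqrtr_gt0 posdef_det_gt0//.
  exact: (riemannian_posdef rg0 Ax).
have cK : cwithin (phi j @` dom j) K.
  apply: cwithin_sum => a _; apply: cwithin_sum => b _; apply: cwithinM.
    apply: (@cwithin_comp _ _ _ (fun x => invmx (g j x) a b) Num.norm).
      exact: norm_continuous.
    exact: riemannian_cwithin_inv.
  by apply: cwithinD; exact: riemannian_cwithin.
have cL : cwithin (phi j @` dom j) L.
  apply: cwithinM.
    apply: cwithinM; first exact: riemannian_cwithin_density.
    by apply: cwithinV => //; exact: riemannian_cwithin_density.
  by apply: cwithinD; [exact: cwithin_cst|exact: cwithinM].
exists (L (phi j q) + 1).
have oL : nbhs (L (phi j q)) [set y | y < L (phi j q) + 1].
  by apply: open_nbhs_nbhs; split; [exact: open_lt|rewrite /= ltrDl].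
have Lq : nbhs (phi j q) [set x | (phi j @` dom j) x -> L x < L (phi j q) + 1] :=
  cL _ (chart_image dq) _ oL.
have /subspace_continuousP/(_ q dq) cphi := @phi_continuous _ _ _ M j.
have Lp : nbhs q [set p | dom j p -> (phi j @` dom j) (phi j p) ->
    L (phi j p) < L (phi j q) + 1] := cphi _ Lq.
have dj : nbhs q (dom j) := open_nbhs_nbhs (conj (@dom_open _ _ _ M j) dq).
apply: filterS2 Lp dj => p Lp djp i di ip.
have {}Lp := Lp djp (chart_image djp).
apply: (comparable_change di djp ip).
have Ap := chart_image djp; set x := phi j p in Lp Ap *.
set C := _ + 1 in Lp *.
have dg0 := d0 _ Ap.
have dge : 0 <= density g j x by exact: sqrtr_ge0.
have dg0e : 0 < density g0 j x by rewrite lt_neqAle eq_sym dg0 sqrtr_ge0.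
have KK1 : 1 <= 1 + K x * K x by rewrite lerDl -expr2 sqr_ge0.
have KK2 : K x <= 1 + K x * K x by have := sqr_ge0 (K x - 1); rewrite sqrrB; lra.
have LE : density g j x * (1 + K x * K x) <= C * density g0 j x.
  by rewrite -ler_pdivrMr// mulrAC ltW.
split.
  by apply: le_trans LE; rewrite -[leLHS]mulr1 ler_wpM2l.
move=> a.
have sg0 := riemannian_sym rg0 Ap; have pg0 := riemannian_posdef rg0 Ap.
have q0 := qform_ge0 sg0 pg0 a.
apply: (@le_trans _ _ ((K x * qform (g0 j x) a a) * density g j x)).
  by rewrite ler_wpM2r//; exact: qform_compare.
have KL : K x * density g j x <= C * density g0 j x.
  by apply: le_trans LE; rewrite mulrC ler_wpM2l.
by have := ler_wpM2l q0 KL; congr (_ <= _); ring.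
Qed.

(** Compactness of [T]: a constant works near each point, and comparability is preserved when the
    constant grows, so the covering form of compactness along the filter at +oo yields one constant
    for all points. *)
Lemma metric_comparison : exists2 C, 0 <= C & forall i p, dom i p ->
  manifold_interior M p -> density g i (phi i p) <= C * density g0 i (phi i p) /\
  forall a, qform (g i (phi i p)) a a * density g i (phi i p) <=
    C * (qform (g0 i (phi i p)) a a * density g0 i (phi i p)).
Proof.
have /compact_near_coveringP cT := manifold_compact M.
have : \forall C \near +oo%R, [set: T] `<=` [set p | forall i, dom i p ->
    manifold_interior M p -> comparable_at C i p].
  apply: (cT R +oo%R (fun C p => forall i, dom i p ->
    manifold_interior M p -> comparable_at C i p)) => q _.
  have [C HC] := local_comparable q.
  exists ([set p | forall i, dom i p -> manifold_interior M p -> comparable_at C i p],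
     [set C' | C <= C']) => /=.
    by split=> //; apply: nbhs_pinfty_ge; exact: num_real.
  move=> [p C'] /= [Hp CC'] i di ip; have [c1 c2] := Hp i di ip.
  have Ap := chart_image di; split.
    by apply: le_trans c1 _; rewrite ler_wpM2r// sqrtr_ge0.
  move=> a; apply: le_trans (c2 a) _; rewrite ler_wpM2r// mulr_ge0 ?sqrtr_ge0//.
  apply: qform_ge0; [exact: riemannian_sym|exact: riemannian_posdef].
move=> H.
have [C [C0 HC]] : exists C : R, 0 <= C /\ [set: T] `<=` [set p | forall i, dom i p ->
    manifold_interior M p -> comparable_at C i p].
  have : \forall C \near +oo%R, 0 <= C /\ [set: T] `<=` [set p | forall i, dom i p ->
    manifold_interior M p -> comparable_at C i p].
    by near=> C; split; near: C => //; apply: nbhs_pinfty_ge; exact: num_real.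
  by move=> /filter_ex.
by exists C => // i p di ip; exact: (HC p I i di ip).
Unshelve. all: by end_near. Qed.

End MetricComparison.

(** * Energy *)

Section Energy.
Variables (R : realType) (m : nat) (T : topologicalType).
Variable M : compact_manifold R m T.
Local Notation n := m.+1.
Local Notation chart := 'I_(charts M).
Local Notation mR := (measurableTypeR R).
Local Notation tup := (n.-tuple mR).
Local Notation FD := ((T -> R) * (chart -> 'rV[R]_n -> 'rV[R]_n))%type.
Implicit Types (i j : chart) (U S Om K : set T) (p : T) (g : tensor M).
Implicit Types (u v : FD) (f h : T -> R).

(** The squared H^1 norm. [H1_sqdist] is by conversion the energy of a difference, so statements
    about distances reduce to statements about this norm. *)
Definition energy g Om (u : FD) : \bar R := integral_vol g Om
  (fun i x => u.1 (psi i x) ^+ 2 + inner g i x (u.2 i x) (u.2 i x)).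

Lemma H1_sqdistE g Om u v : H1_sqdist g Om u v = energy g Om (u - v).
Proof. by []. Qed.

Lemma piece_point Om i (t : tup) : piece Om i t ->
  [/\ dom i (psi i (vec t)), Om (psi i (vec t)) & phi i (psi i (vec t)) = vec t].
Proof. by move=> [[p dp pt] [Ot _]]; rewrite -{1 3}pt phiK//; split=> //; rewrite pt. Qed.

Lemma mfieldD Om u v : mfield u Om -> mfield v Om -> mfield (u + v) Om.
Proof.
move=> [u1 u2] [v1 v2]; split=> [i|a i].
  exact: (measurable_funD (u1 i) (v1 i)).
have := measurable_funD (u2 a i) (v2 a i); congr measurable_fun.
by apply/funext => t /=; rewrite mxE.
Qed.

Lemma mfieldN Om u : mfield u Om -> mfield (- u) Om.
Proof.
move=> [u1 u2]; split=> [i|a i].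
  exact: (measurable_funN (u1 i)).
have := measurable_funN (u2 a i); congr measurable_fun.
by apply/funext => t /=; rewrite mxE.
Qed.

Lemma mfieldB Om u v : mfield u Om -> mfield v Om -> mfield (u - v) Om.
Proof. by move=> mu mv; apply: mfieldD => //; exact: mfieldN. Qed.

Lemma mfieldS Om Om' u : measurable_region M Om' -> Om `<=` Om' ->
  mfield u Om' -> mfield u Om.
Proof. by move=> mO OO' [u1 u2]; split=> [|a]; apply: piece_funS OO' _. Qed.

Lemma energy_piece_fun g Om u : riemannian g -> mfield u Om ->
  piece_fun (fun i x => u.1 (psi i x) ^+ 2 + inner g i x (u.2 i x) (u.2 i x)) Om.
Proof.
move=> rg mu i; apply: measurable_funD.
  by apply: measurable_funX; exact: mu.1.
exact: (measurable_piece_inner rg mu mu).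
Qed.

Lemma inner_ge0 g i x (a : 'rV[R]_n) : riemannian g -> (phi i @` dom i) x ->
  0 <= inner g i x a a.
Proof.
by move=> rg Ax; apply: qform_ge0; [exact: riemannian_sym|exact: riemannian_posdef].
Qed.

Lemma energy_fun_ge0 g Om u i (t : tup) : riemannian g -> piece Om i t ->
  0 <= u.1 (psi i (vec t)) ^+ 2 + inner g i (vec t) (u.2 i (vec t)) (u.2 i (vec t)).
Proof. by move=> rg pt; rewrite addr_ge0 ?sqr_ge0 ?inner_ge0//; case: pt. Qed.

Lemma energy_ge0 g Om u : riemannian g -> (0 <= energy g Om u)%E.
Proof. by move=> rg; apply: integral_vol_ge0 => i t pt; exact: (energy_fun_ge0 _ rg pt). Qed.

(** A substitute for the triangle inequality that avoids square roots, from |a + b|^2 <= 2|a|^2 +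
    2|b|^2 for the function and the covector parts. *)
Lemma energyD_le g Om u v : riemannian g -> measurable_region M Om ->
  mfield u Om -> mfield v Om ->
  (energy g Om (u + v)%R <= 2%:E * energy g Om u + 2%:E * energy g Om v)%E.
Proof.
move=> rg mO mu mv.
have Eu := energy_piece_fun rg mu; have Ev := energy_piece_fun rg mv.
have Euv := energy_piece_fun rg (mfieldD mu mv).
rewrite /energy -!integral_volZ//; try by move=> i t pt; exact: (energy_fun_ge0 _ rg pt).
have m2 (F : chart -> 'rV[R]_n -> R) : piece_fun F Om ->
    piece_fun (fun i x => 2 * F i x) Om.
  by move=> mF i; apply: measurable_funM; [exact: measurable_cst|exact: mF].
rewrite -integral_volD//.
- apply: le_integral_vol => //.
  + by move=> i; exact: (measurable_funD (m2 _ Eu i) (m2 _ Ev i)).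
  + by move=> i t pt; exact: (energy_fun_ge0 _ rg pt).
  + move=> i t pt; rewrite ler_wpM2r ?density_ge0//.
    have Ax : (phi i @` dom i) (vec t) by case: pt.
    have := qformD_le (riemannian_sym rg Ax) (riemannian_posdef rg Ax)
      (u.2 i (vec t)) (v.2 i (vec t)).
    rewrite -!innerE /=; have := sqr_ge0 (u.1 (psi i (vec t)) - v.1 (psi i (vec t))).
    rewrite sqrrB sqrrD; lra.
- exact: m2.
- exact: m2.
- by move=> i t pt; rewrite mulr_ge0// (energy_fun_ge0 _ rg pt).
- by move=> i t pt; rewrite mulr_ge0// (energy_fun_ge0 _ rg pt).
Qed.

Lemma eq_energy g Om u v :
  (forall i t, piece Om i t -> u.1 (psi i (vec t)) = v.1 (psi i (vec t)) /\
    u.2 i (vec t) = v.2 i (vec t)) ->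
  energy g Om u = energy g Om v.
Proof. by move=> uv; apply: eq_integral_vol => i t /uv[-> ->]. Qed.

Lemma energyN g Om u : energy g Om (- u) = energy g Om u.
Proof.
apply: eq_integral_vol => i t _ /=.
by rewrite sqrrN !innerE qformNl qformNr opprK.
Qed.

Lemma energyS g Om Om' u : riemannian g -> measurable_region M Om ->
  measurable_region M Om' -> Om `<=` Om' -> mfield u Om' ->
  (energy g Om u <= energy g Om' u)%E.
Proof.
move=> rg mO mO' OO' mu; apply: subset_integral_vol => //.
  exact: energy_piece_fun.
by move=> i t pt; exact: (energy_fun_ge0 _ rg pt).
Qed.

(** The constant depends neither on the region nor on [u], so convergence for one metric passes to
    any other. *)
Lemma energy_compare g g0 : riemannian g -> riemannian g0 ->
  exists2 C : R, 0 <= C & forall Om u, Om `<=` manifold_interior M ->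
    measurable_region M Om -> mfield u Om ->
    (energy g Om u <= C%:E * energy g0 Om u)%E.
Proof.
move=> rg rg0; have [C C0 HC] := metric_comparison rg rg0.
exists C => // Om u iO mO mu.
have Eu := energy_piece_fun rg mu; have Eu0 := energy_piece_fun rg0 mu.
rewrite /energy -integral_volZ//; last by move=> i t pt; exact: (energy_fun_ge0 _ rg0 pt).
apply: le_integral_vol => //.
- by move=> i; apply: measurable_funM; [exact: measurable_cst|exact: Eu0].
- by move=> i t pt; exact: (energy_fun_ge0 _ rg pt).
- move=> i t /piece_point[di /iO ip pE].
  have [H1 /(_ (u.2 i (vec t))) H2] := HC _ _ di ip.
  rewrite pE in H1 H2; rewrite !innerE.
  have := ler_wpM2l (sqr_ge0 (u.1 (psi i (vec t)))) H1; lra.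
Qed.

(** Function and differential are extended separately; that the result is an element of H^1 is a
    matter of the trace, see [ext0_trace0]. *)
Definition ext0 Om u : FD := (fun p => if p \in Om then u.1 p else 0,
  fun i x => if psi i x \in Om then u.2 i x else 0).

Lemma ext0B Om u v : ext0 Om (u - v) = ext0 Om u - ext0 Om v.
Proof.
congr pair; [apply/funext => p /=|apply/funext => i; apply/funext => x /=].
  transitivity ((if p \in Om then u.1 p else 0) - (if p \in Om then v.1 p else 0)) => //.
  by case: (p \in Om) => //; rewrite subr0.
transitivity ((if psi i x \in Om then u.2 i x else 0) -
  (if psi i x \in Om then v.2 i x else 0)) => //.
by case: (psi i x \in Om) => //; rewrite subr0.
Qed.

Lemma ext0_in Om u i (t : tup) : piece Om i t ->
  (ext0 Om u).1 (psi i (vec t)) = u.1 (psi i (vec t)) /\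
  (ext0 Om u).2 i (vec t) = u.2 i (vec t).
Proof. by move=> [_ [Ot _]]; rewrite /ext0 /= mem_set. Qed.

Lemma ext0_out Om u i (x : 'rV[R]_n) : ~ Om (psi i x) ->
  (ext0 Om u).1 (psi i x) = 0 /\ (ext0 Om u).2 i x = 0.
Proof. by move=> nO; rewrite /ext0 /= memNset. Qed.

Lemma energy_ext0 g Om Om' u : Om `<=` Om' -> energy g Om' (ext0 Om u) = energy g Om u.
Proof.
move=> OO'; rewrite /energy (integral_vol_support g OO').
  by apply: eq_energy => i t; exact: ext0_in.
move=> i t _ nO; have [-> ->] := ext0_out u nO.
by rewrite innerE qform0l expr0n addr0.
Qed.

Lemma mfield_ext0 Om Om' u : measurable_region M Om -> measurable_region M Om' ->
  Om `<=` Om' -> mfield u Om -> mfield (ext0 Om u) Om'.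
Proof.
move=> mO mO' OO' [u1 u2].
have patchE (F : chart -> 'rV[R]_n -> R) : piece_fun F Om ->
    piece_fun (fun i x => if psi i x \in Om then F i x else 0) Om'.
  move=> mF i; have mp := measurable_piece i mO'.
  have H : measurable_fun (piece Om' i `&` piece Om i) (fun t => F i (vec t)).
    by rewrite setIidr; [exact: mF|exact: piece_sub].
  have {}H := (measurable_restrict (fun t : tup => F i (vec t)) (measurable_piece i mO) mp).1 H.
  apply: eq_measurable_fun H => t /set_mem pt; rewrite /patch.
  case: ifPn => [/set_mem[_ [Ot _]]|nt]; first by rewrite mem_set.
  rewrite memNset// => Ot; move/negP: nt; apply; apply/mem_set.
  by case: pt => At [_ H]; split.
split=> [|a i]; first exact: (patchE (fun i x => u.1 (psi i x))).
have := patchE (fun i x => u.2 i x 0 a) (u2 a) i; congr measurable_fun.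
by apply/funext => t /=; case: ifP => // _; rewrite mxE.
Qed.

End Energy.

(** * Functions smooth up to the boundary *)

Section SmoothFun.
Variables (R : realType) (m : nat) (T : topologicalType).
Variable M : compact_manifold R m T.
Local Notation n := m.+1.
Local Notation chart := 'I_(charts M).
Local Notation mR := (measurableTypeR R).
Local Notation tup := (n.-tuple mR).
Local Notation FD := ((T -> R) * (chart -> 'rV[R]_n -> 'rV[R]_n))%type.
Local Notation wd := (@with_diff R m T M).
Implicit Types (i j : chart) (U S Om K : set T) (p : T) (g : tensor M).
Implicit Types (u v : FD) (f h : T -> R).

(** Common ground for the whole manifold with its interior and for the subdomain with its
    topological interior, so that the Sobolev facts are proved once for both. The last clause makes
    derivatives at points of [Om] depend only on values in [K]. *)
Definition admissible K Om := [/\ Om `<=` manifold_interior M,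
  measurable_region M Om &
  forall i p, dom i p -> Om p -> nbhs (phi i p) (chart_set i K)].

Lemma admissible_full : admissible [set: T] (manifold_interior M).
Proof.
split=> //; first exact: measurable_region_interior.
by move=> i p dp ip; apply: chart_nbhs => //; exact: openT.
Qed.

Lemma admissible_interior K : K `<=` manifold_interior M -> admissible K (interior K).
Proof.
move=> KM; have iK := @interior_subset _ K.
split; [exact: subset_trans KM|apply: measurable_region_open; exact: open_interior|].
move=> i p dp ip; have := chart_nbhs (@open_interior _ K) ip dp (KM _ (iK _ ip)).
by apply: filterS => x [Ax Kx]; split=> //; exact: iK.
Qed.

Lemma smooth_funP K f : smooth_fun M K f <-> forall i x, chart_set i K x ->
  exists V H, [/\ open V, V x, forall k, is_Ck k V H &
    forall y, chart_set i K y -> V y -> H y = f (psi i y)].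
Proof.
by split=> H i x; have := H i x; rewrite chart_setE.
Qed.

(** Around a point of [Om] the local smooth extension coincides with the function on a full
    neighbourhood, so the function itself is of class C^k there. *)
Lemma smooth_fun_near K Om f i p : admissible K Om -> smooth_fun M K f ->
  dom i p -> Om p -> exists V, [/\ open V, V (phi i p), V `<=` chart_set i K &
    forall k, is_Ck k V (f \o psi i)].
Proof.
move=> [_ _ nK] /smooth_funP sf dp Op.
have [V0 [H [oV Vp cH Hf]]] := sf i _ (nbhs_singleton (nK i p dp Op)).
have oI : open (interior (chart_set i K)) by exact: open_interior.
exists (V0 `&` interior (chart_set i K)); split.
- exact: openI.
- by split=> //; exact: (nK i p dp Op).
- by move=> x [_ /interior_subset].
- move=> k; apply: (@is_Ck_ext _ _ _ _ H); first exact: openI.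
    by move=> x [Vx /interior_subset Kx]; rewrite /= Hf.
  by apply: is_Ck_sub (cH k) => x [].
Qed.

Lemma smooth_funD K f h : smooth_fun M K f -> smooth_fun M K h -> smooth_fun M K (f + h).
Proof.
move=> /smooth_funP sf /smooth_funP sh; apply/smooth_funP => i x Kx.
have [V [F [oV Vx cF Ff]]] := sf i x Kx; have [W [H [oW Wx cH Hh]]] := sh i x Kx.
exists (V `&` W), (F + H); split=> //; first exact: openI.
  move=> k; apply: is_CkD; first exact: openI.
    by apply: is_Ck_sub (cF k) => y [].
  by apply: is_Ck_sub (cH k) => y [].
by move=> y Ky [Vy Wy]; rewrite -[LHS]/(F y + H y) Ff// Hh.
Qed.

Lemma smooth_funN K f : smooth_fun M K f -> smooth_fun M K (- f).
Proof.
move=> /smooth_funP sf; apply/smooth_funP => i x Kx.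
have [V [F [oV Vx cF Ff]]] := sf i x Kx.
exists V, (cst (-1) * F); split=> //.
  by move=> k; apply: is_CkM => //; exact: is_Ck_cst.
by move=> y Ky Vy; rewrite -[LHS]/(-1 * F y) Ff// mulN1r.
Qed.

Lemma smooth_fun_cst K (c : R) : smooth_fun M K (cst c).
Proof.
apply/smooth_funP => i x Kx; exists setT, (cst c); split=> //; first exact: openT.
by move=> k; exact: is_Ck_cst.
Qed.

Lemma smooth_funS K K' f : K `<=` K' -> smooth_fun M K' f -> smooth_fun M K f.
Proof.
move=> KK' /smooth_funP sf; apply/smooth_funP => i x [Ax Kx].
have [V [F [oV Vx cF Ff]]] := sf i x (conj Ax (KK' _ Kx)).
by exists V, F; split=> // y [Ay Ky]; apply: Ff; split=> //; exact: KK'.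
Qed.

Section Admissible.
Variables (K Om : set T).
Hypothesis aK : admissible K Om.

Lemma smooth_fun_derivable f i (t : tup) a : smooth_fun M K f -> piece Om i t ->
  derivable (f \o psi i) (vec t) (delta_mx 0 a).
Proof.
move=> sf /piece_point[dp Op <-].
have [V [_ Vx _ /(_ 1%N) cf]] := smooth_fun_near aK sf dp Op.
exact: is_Ck_derivable cf Vx.
Qed.

Lemma mfield_with_diff f : smooth_fun M K f -> mfield (wd f) Om.
Proof.
move=> sf; have [OM mO nK] := aK.
have mF (F : chart -> 'rV[R]_n -> R) : (forall i p, dom i p -> Om p -> {for phi i p, continuous (F i)}) -> piece_fun F Om.
  move=> cF i.
  (* [measurable_cwithin] expects a set of row vectors, whereas pieces are sets of tuples. *)
  pose B := [set x : 'rV[R]_n | piece Om i [tuple x 0 j | j < n]].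
  have vecK (t : tup) : [tuple vec t 0 j | j < n] = t.
    by apply: eq_from_tnth => j; rewrite tnth_mktuple mxE.
  have BE : piece Om i = @vec R n @^-1` B.
    by apply/seteqP; split=> t; rewrite /B /= vecK.
  rewrite BE; apply: measurable_cwithin; first by rewrite -BE; exact: measurable_piece.
  apply: continuous_cwithin => x; rewrite /B /= => /piece_point.
  have -> : vec [tuple x 0 j | j < n] = x by apply/rowP => j; rewrite mxE tnth_mktuple.
  by move=> [dp Op xE]; rewrite -xE; exact: cF.
split=> [|a].
  apply: mF => i p dp Op.
  by have [V [_ Vx _ /(_ 0%N)[cf _]]] := smooth_fun_near aK sf dp Op; exact: cf.
have H : piece_fun (fun i x => partial a (f \o psi i) x) Om.
  apply: mF => i p dp Op.
  have [V [_ Vx _ /(_ 1%N)[_ /(_ a)[_ [cf _]]]]] := smooth_fun_near aK sf dp Op.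
  exact: cf.
by move=> i; have := H i; congr measurable_fun; apply/funext => t /=; rewrite mxE.
Qed.

(** Additivity of the differential is claimed on the pieces only, where the functions are known to
    be derivable. *)
Lemma with_diffD f h : smooth_fun M K f -> smooth_fun M K h -> forall i t, piece Om i t ->
  (wd (f + h)).1 (psi i (vec t)) = (wd f + wd h).1 (psi i (vec t)) /\
  (wd (f + h)).2 i (vec t) = (wd f + wd h).2 i (vec t).
Proof.
move=> sf sh i t pt; split=> //; apply/rowP => a; rewrite !mxE.
rewrite -[RHS]deriveD//; exact: (smooth_fun_derivable (t := t)).
Qed.

Lemma with_diffN f : smooth_fun M K f -> forall i t, piece Om i t ->
  (wd (- f)).1 (psi i (vec t)) = (- wd f).1 (psi i (vec t)) /\
  (wd (- f)).2 i (vec t) = (- wd f).2 i (vec t).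
Proof.
move=> sf i t pt; split=> //; apply/rowP => a; rewrite !mxE.
by rewrite -[RHS]deriveN//; exact: (smooth_fun_derivable (t := t)).
Qed.

End Admissible.

Lemma zero_diffE : zero_diff M = (0 : FD).
Proof.
rewrite /zero_diff /with_diff; congr pair.
apply/funext => i; apply/funext => x; apply/rowP => a; rewrite !mxE.
exact: derive_cst.
Qed.

End SmoothFun.

(** * Truncation *)

Section Chi.
Variable R : realType.
Implicit Types c t y q : R.

Definition chi c t := t * flat 1 ((c * t) ^+ 2 - 1).

(** The derivative of [chi c]: by [is_derive_flat], [flat 1] has derivative [flat 'X^2]. *)
Definition dchi c t := flat 1 ((c * t) ^+ 2 - 1) +
  2 * (c * t) ^+ 2 * flat 'X^2 ((c * t) ^+ 2 - 1).

Lemma flat1_itv q : 0 <= flat 1 q <= 1.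
Proof.
rewrite /flat; case: ifP => [q0|_]; last by rewrite lexx ler01.
by rewrite hornerC mul1r expR_ge0 -expR0 ler_expR oppr_le0 invr_ge0 ltW.
Qed.

Lemma chi_sub_sqr c t : (chi c t - t) ^+ 2 <= t ^+ 2.
Proof.
have /andP[f0 f1] := flat1_itv ((c * t) ^+ 2 - 1).
have -> : chi c t - t = t * (flat 1 ((c * t) ^+ 2 - 1) - 1) by rewrite /chi; ring.
rewrite exprMn ler_piMr ?sqr_ge0//.
by move: f0 f1; set f := flat _ _ => *; nra.
Qed.

Lemma chi_small c t : `|c * t| <= 1 -> chi c t = 0.
Proof.
move=> ct; rewrite /chi flat_le0 ?mulr0// subr_le0.
by rewrite -[_ ^+ 2]ger0_norm ?sqr_ge0// normrX expr_le1.
Qed.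

(** [dchi] in the variable y = 1/((ct)^2 - 1), that is (ct)^2 = 1 + 1/y. As c grows with t nonzero,
    y tends to 0, where the value is 1. *)
Let psi0 y := expR (- y) * (1 + 2 * y + 2 * y ^+ 2).

Let dchiE c t : 1 < (c * t) ^+ 2 -> dchi c t = psi0 ((c * t) ^+ 2 - 1)^-1.
Proof.
rewrite /dchi /psi0; move: (_ ^+ 2) => s s1; rewrite /flat subr_gt0 s1 hornerC hornerXn.
have : s - 1 != 0 by rewrite gt_eqF// subr_gt0.
by move=> ?; field.
Qed.

Lemma dchi_small c t : (c * t) ^+ 2 <= 1 -> dchi c t = 0.
Proof. by rewrite -subr_le0 => q0; rewrite /dchi !flat_le0// mulr0 addr0. Qed.

(** [dchi] takes values between 0 and 7, so its distance to 1 is at most 6. The bound is uniform in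
    [c], as dominated convergence requires. *)
Lemma dchi_sub_sqr c t : (dchi c t - 1) ^+ 2 <= 36.
Proof.
have [ct|ct] := leP ((c * t) ^+ 2) 1.
  by rewrite dchi_small//; lra.
rewrite dchiE// /psi0; set y := _^-1.
have y0 : 0 < y by rewrite invr_gt0 subr_gt0.
have e1 : 1 + y <= expR y by exact: expR_ge1Dx.
have e2 : 1 + y ^+ 2 / 2 <= expR y by exact: (expR_ge1Dxn 1 (ltW y0)).
have lo : 0 <= expR (- y) * (1 + 2 * y + 2 * y ^+ 2).
  by rewrite mulr_ge0 ?expR_ge0//; nra.
have hi : expR (- y) * (1 + 2 * y + 2 * y ^+ 2) <= 7.
  rewrite expRN mulrC ler_pdivrMr ?expR_gt0//; lra.
by move: lo hi; set z := expR _ * _ => *; nra.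
Qed.

Lemma is_derive_chi n c (F : 'rV[R]_n -> R) x (v : 'rV[R]_n) : derivable F x v ->
  is_derive x v (chi c \o F) (dchi c (F x) * 'D_v F x).
Proof.
move=> dF; have dF' := derivableP dF.
pose Q : 'rV[R]_n -> R := (cst c * F) ^+ 2 - cst 1.
have dQ : is_derive x v Q (2 * c ^+ 2 * F x * 'D_v F x).
  rewrite /Q; apply: is_derive_eq.
  by rewrite /= subr0 /GRing.scale /= expr1 mulr0 addr0; rewrite -[(cst c * F) x]/(c * F x); ring.
have [dQ1 dQ2] := dQ.
have dC := is_derive_comp (is_derive_flat 1 (Q x)) dQ1.
rewrite dQ2 in dC.
have := is_deriveM dF' dC.
rewrite -[F * _]/(chi c \o F) => H; apply: is_derive_eq H _.
have -> : Q x = (c * F x) ^+ 2 - 1 by [].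
rewrite /dchi /GRing.scale /= derivC subr0 mulr1; ring.
Qed.

Lemma is_Ck_chi n k c (F : 'rV[R]_n -> R) V : open V -> is_Ck k V F -> is_Ck k V (chi c \o F).
Proof.
move=> oV cF; apply: (@is_CkM _ _ _ _ F) => //.
apply: (@is_Ck_flat _ _ _ _ ((cst c * F) * (cst c * F) + cst (-1))) => //.
by apply: is_CkD => //; [apply: is_CkM => //; apply: is_CkM|]; try exact: is_Ck_cst.
Qed.

Let near_large t (A : R) : t != 0 -> \forall l \near \oo, A < (l.+1%:R * t) ^+ 2.
Proof.
move=> t0; have t20 : 0 < t ^+ 2 by rewrite exprn_even_gt0.
near=> l; rewrite exprMn -ltr_pdivrMr//.
have Al : A / t ^+ 2 < l%:R by near: l; exact: nbhs_infty_gtr.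
apply: lt_le_trans Al _; rewrite expr2 -natrM ler_nat.
  by apply: leq_trans (leqnSn l) _; exact: leq_pmulr.
Unshelve. all: by end_near. Qed.

Let cvg_inv t : t != 0 -> (((l.+1%:R * t) ^+ 2 - 1)^-1) @[l --> \oo] --> (0 : R).
Proof.
move=> t0; apply/cvgr0Pnorm_lt => e e0; near=> l.
have H : e^-1 + 1 < (l.+1%:R * t) ^+ 2 by near: l; exact: near_large.
have ei : 0 < e^-1 by rewrite invr_gt0.
have q0 : 0 < (l.+1%:R * t) ^+ 2 - 1 by lra.
rewrite gtr0_norm ?invr_gt0// invf_plt ?posrE//; lra.
Unshelve. all: by end_near. Qed.

(** At t = 0 the value is 0 for every parameter, so convergence to 1 holds only off the zero set. *)
Lemma cvg_dchi t : t != 0 -> dchi l.+1%:R t @[l --> \oo] --> (1 : R).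
Proof.
move=> t0.
have c0 : {for (0:R), continuous psi0}.
  apply: continuousM.
    by apply: continuous_comp; [exact: continuousN|exact: continuous_expR].
  apply: continuousD.
    apply: continuousD; first exact: cst_continuous.
    by apply: continuousM; [exact: cst_continuous|].
  by apply: continuousM; [exact: cst_continuous|exact: exprn_continuous].
rewrite [X in _ --> X](_ : 1 = psi0 0); last by rewrite /psi0 oppr0 expR0; ring.
apply: cvg_trans (cvg_comp _ _ (cvg_inv t0) c0); apply: near_eq_cvg.
by apply: filterS (near_large 1 t0) => l tl; rewrite /= dchiE.
Unshelve. all: by end_near. Qed.

Lemma cvg_chi t : chi l.+1%:R t @[l --> \oo] --> t.
Proof.
have [->|t0] := eqVneq t 0.
  under eq_fun do rewrite /chi mul0r; exact: cvg_cst.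
have c0 : {for (0:R), continuous (fun y => t * expR (- y))}.
  apply: continuousM; first exact: cst_continuous.
  by apply: continuous_comp; [exact: continuousN|exact: continuous_expR].
rewrite [X in _ --> X](_ : t = t * expR (- 0)); last by rewrite oppr0 expR0 mulr1.
apply: cvg_trans (cvg_comp _ _ (cvg_inv t0) c0); apply: near_eq_cvg.
by apply: filterS (near_large 1 t0) => l tl; rewrite /= /chi /flat subr_gt0 tl hornerC mul1r.
Unshelve. all: by end_near. Qed.

Let measurable_flat_comp c P : measurable_fun setT (fun t => flat P ((c * t) ^+ 2 - 1)).
Proof.
apply: measurableT_comp; first by apply: continuous_measurable_fun; exact: continuous_flat.
by apply: measurable_funB => //; apply: measurable_funX; apply: measurable_funM.
Qed.

Lemma measurable_chi c : measurable_fun setT (chi c).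
Proof. exact: measurable_funM (measurable_flat_comp c 1). Qed.

Lemma measurable_dchi c : measurable_fun setT (dchi c).
Proof.
apply: measurable_funD; first exact: measurable_flat_comp.
apply: measurable_funM; last exact: measurable_flat_comp.
by apply: measurable_funM => //; apply: measurable_funX; apply: measurable_funM.
Qed.

End Chi.

(** * Zeros with nonvanishing derivative *)

Section Null.
Variables (R : realType) (n : nat).
Local Notation tup := (n.-tuple (measurableTypeR R)).

(* On a line parallel to the a-th axis, the zeros of F at which its derivative
   does not vanish are isolated. *)
Lemma null_critical (F : 'rV[R]_n -> R) (a : 'I_n) (D : set tup) :
  (forall t, D t -> derivable F (vec t) (delta_mx 0 a)) ->
  measurable [set t | [/\ D t, F (vec t) = 0 & partial a F (vec t) != 0]] ->
  tuple_measure R n [set t | [/\ D t, F (vec t) = 0 & partial a F (vec t) != 0]] = 0%E.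
Proof.
move=> dF mN; apply: (lebesgue_tuple_countable_lines (a := a)) => //.
  by rewrite tuple_measureE.
move=> t0; set S := [set s | _].
(* A set of reals all of whose points are isolated is countable. *)
suff SI : S `<=` isolated S.
  by apply: sub_countable (countable_isolated S); exact: subset_card_le.
move=> s Ss; have [Dt F0 dF0] := Ss.
set x := vec (set_tup t0 a s) in F0 dF0.
have line r : vec (set_tup t0 a r) = (r - s) *: delta_mx 0 a + x.
  apply/rowP => j; rewrite !mxE !tnth_mktuple eqxx /=.
  by case: ifP => _; rewrite ?mulr1 ?subrK ?mulr0 ?add0r.
have dl : derivable F x (delta_mx 0 a) := dF _ Dt.
(* The difference quotient has a nonzero limit, so it is nonzero close to the point; since [F]
   vanishes at the point itself, [F] is nonzero at the neighbouring points of the line. *)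
have H : nbhs (0 : R) [set h | h != 0 -> F (h *: delta_mx 0 a + x) != 0].
  have : \forall h \near 0^', h^-1 *: (F (h *: delta_mx 0 a + x) - F x) != 0.
    exact: (dl [set y | y != 0] (open_nbhs_nbhs (conj (@open_neq R 0) dF0))).
  rewrite near_withinE; apply: filterS => h Hh /Hh; rewrite F0 subr0.
  by apply: contra_neq => ->; rewrite scaler0.
split; first exact/mem_set.
exists [set r | r - s != 0 -> F ((r - s) *: delta_mx 0 a + x) != 0].
  have cs : (r - s) @[r --> s] --> (0 : R).
    by rewrite -[X in _ --> X](subrr s); apply: cvgB; [exact: cvg_id|exact: cvg_cst].
  exact: (cs _ H).
apply/seteqP; split=> [r [Hr [_ Fr _]]|_ ->]; last first.
  by split=> //; rewrite /= subrr eqxx.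
apply/eqP; rewrite -subr_eq0; apply: contraT => /Hr.
by rewrite -line Fr eqxx.
Qed.
End Null.

Section Truncation.
Variables (R : realType) (m : nat) (T : topologicalType).
Variable M : compact_manifold R m T.
Local Notation n := m.+1.
Local Notation chart := 'I_(charts M).
Local Notation mR := (measurableTypeR R).
Local Notation tup := (n.-tuple mR).
Local Notation FD := ((T -> R) * (chart -> 'rV[R]_n -> 'rV[R]_n))%type.
Local Notation wd := (@with_diff R m T M).
Local Notation Om2 := (manifold_interior M).
Variables (K : set T) (w : T -> R).
Hypotheses (cK : closed K) (KM : K `<=` Om2) (sw : smooth_fun M K w).
Hypothesis w0 : forall p, (K `\` interior K) p -> w p = 0.
Local Notation Om := (interior K).

(** Zero is imposed off the interior of [K], because [w] is a total function with arbitrary values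
    outside [K]. The shift [l.+1] keeps the parameter positive. *)
Definition truncation (l : nat) : T -> R :=
  fun p => if p \in (Om : set T) then chi l.+1%:R (w p) else 0.

Let aK := admissible_interior KM.

Lemma truncation_out l p : ~ Om p -> truncation l p = 0.
Proof. by move=> nO; rewrite /truncation memNset. Qed.

(** Off [K] this is openness of the complement. At a boundary point of [K], a local smooth extension
    [H] of [w] vanishes, so |c H| < 1 nearby, and [chi] is zero on such values. *)
Lemma truncation_zero_near l (i : chart) p : dom i p -> ~ Om p ->
  exists V, [/\ open V, V (phi i p) &
    forall y, (phi i @` dom i) y -> V y -> truncation l (psi i y) = 0].
Proof.
move=> dp nOp; have [Kp|nKp] := pselect (K p); last first.
  have [V oV VE] := chart_set_open i (closed_openC cK).
  have : chart_set i (~` K) (phi i p) by split; [exists p|rewrite /= phiK].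
  rewrite VE => -[_ Vp]; exists V; split=> // y Ay Vy.
  apply: truncation_out => /interior_subset.
  by have [] : chart_set i (~` K) y by rewrite VE.
have [V [H [oV Vp cH Hw]]] : exists V H, [/\ open V, V (phi i p),
    forall k, is_Ck k V H & forall y, chart_set i K y -> V y -> H y = w (psi i y)].
  have /smooth_funP := sw; apply; split; first by exists p.
  by rewrite /= phiK.
have Hp : H (phi i p) = 0.
  rewrite Hw ?phiK//; last by split; [exists p|rewrite /= phiK].
  exact: w0.
have [cont _] := cH 0%N.
have : nbhs (phi i p) [set y | `|l.+1%:R * H y| < 1].
  have oN : nbhs (H (phi i p)) [set z | `|l.+1%:R * z| < 1].
    rewrite Hp; apply/nbhs_ballP; exists l.+1%:R^-1 => /=; first by rewrite invr_gt0.
    move=> z; rewrite /ball /= sub0r normrN => zl.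
    by rewrite normrM ger0_norm// -ltr_pdivlMl// mulr1.
  exact: (cont _ Vp _ oN).
rewrite nbhsE => -[W [oW Wp] WH]; exists (V `&` W); split=> //; first exact: openI.
move=> y Ay [Vy Wy]; rewrite /truncation; case: ifPn => // /set_mem Oy.
apply: chi_small; rewrite -Hw//; first by apply: ltW; exact: WH.
by split=> //; exact: (interior_subset Oy).
Qed.

Lemma smooth_truncation l : smooth_fun M [set: T] (truncation l).
Proof.
apply/smooth_funP => i _ [[p dp <-] _]; have [Op|nOp] := pselect (Om p); last first.
  have [V [oV Vp V0]] := truncation_zero_near l dp nOp.
  exists V, (cst 0); split=> //; first by move=> k; exact: is_Ck_cst.
  by move=> y [Ay _] Vy; rewrite V0.
have [V [oV Vp VK cw]] := smooth_fun_near aK sw dp Op.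
have := chart_nbhs (@open_interior _ K) Op dp (KM (interior_subset Op)).
rewrite nbhsE => -[W [oW Wp] WO].
exists (V `&` W), (chi l.+1%:R \o (w \o psi i)); split=> //; first exact: openI.
  move=> k; apply: is_Ck_chi; first exact: openI.
  by apply: is_Ck_sub (cw k) => x [].
by move=> y _ [_ /WO[_ Oy]]; rewrite /truncation mem_set.
Qed.

Lemma with_diff_truncation_in l i (t : tup) : piece Om i t ->
  (wd (truncation l)).1 (psi i (vec t)) = chi l.+1%:R (w (psi i (vec t))) /\
  (wd (truncation l)).2 i (vec t) =
    dchi l.+1%:R (w (psi i (vec t))) *: (wd w).2 i (vec t).
Proof.
move=> pt; have [dp Op pE] := piece_point pt; split.
  by rewrite /= /truncation mem_set.
apply/rowP => a; rewrite !mxE.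
have dw := smooth_fun_derivable aK (a := a) sw pt.
have [_ <-] := is_derive_chi l.+1%:R dw.
apply/esym; apply: near_eq_derive; rewrite -pE.
have := chart_nbhs (@open_interior _ K) Op dp (KM (interior_subset Op)).
by apply: filterS => x [Ax Ox]; rewrite /truncation /= mem_set.
Qed.

Lemma with_diff_truncation_out l i (t : tup) : piece Om2 i t -> ~ Om (psi i (vec t)) ->
  (wd (truncation l)).1 (psi i (vec t)) = 0 /\ (wd (truncation l)).2 i (vec t) = 0.
Proof.
move=> pt nO; have [dp ip pE] := piece_point pt; split; first exact: truncation_out.
have [V [oV Vp V0]] := truncation_zero_near l dp nO.
apply/rowP => a; rewrite !mxE -[RHS](derive_cst (0:R) (vec t) (delta_mx 0 a)).
apply: near_eq_derive; rewrite -pE.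
have := chart_nbhs openT I dp ip; have := open_nbhs_nbhs (conj oV Vp).
by apply: filterS2 => x Vx [Ax _]; rewrite /= V0.
Qed.

Lemma energy_truncation g l : energy g Om2 (wd (truncation l) - ext0 Om (wd w)) =
  integral_vol g Om (fun i x => (chi l.+1%:R (w (psi i x)) - w (psi i x)) ^+ 2 +
    (dchi l.+1%:R (w (psi i x)) - 1) ^+ 2 * inner g i x ((wd w).2 i x) ((wd w).2 i x)).
Proof.
have OM : Om `<=` Om2 by apply: subset_trans KM; exact: interior_subset.
rewrite /energy (integral_vol_support _ OM).
  apply: eq_integral_vol => i t pt; congr (_ * _).
  have [t1 t2] := with_diff_truncation_in l pt; have [e1 e2] := ext0_in (wd w) pt.
  have -> : (wd (truncation l) - ext0 Om (wd w)).1 (psi i (vec t)) =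
    chi l.+1%:R (w (psi i (vec t))) - w (psi i (vec t)).
    by rewrite -t1 -[w _]e1.
  have -> : (wd (truncation l) - ext0 Om (wd w)).2 i (vec t) =
    (dchi l.+1%:R (w (psi i (vec t))) - 1) *: (wd w).2 i (vec t).
    rewrite scalerBl scale1r -t2 -e2 //.
  by rewrite !innerE qformZl qformZr mulrA -expr2.
move=> i t pt nO.
have [t1 t2] := with_diff_truncation_out l pt nO; have [e1 e2] := ext0_out (wd w) nO.
have -> : (wd (truncation l) - ext0 Om (wd w)).1 (psi i (vec t)) = 0.
  by rewrite -[RHS]subr0 -{1}t1 -e1.
have -> : (wd (truncation l) - ext0 Om (wd w)).2 i (vec t) = 0.
  by rewrite -[RHS]subr0 -{1}t2 -e2.
by rewrite innerE qform0l expr0n addr0.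
Qed.

End Truncation.

Section TruncationCvg.
Variables (R : realType) (m : nat) (T : topologicalType).
Variable M : compact_manifold R m T.
Local Notation n := m.+1.
Local Notation chart := 'I_(charts M).
Local Notation mR := (measurableTypeR R).
Local Notation tup := (n.-tuple mR).
Local Notation FD := ((T -> R) * (chart -> 'rV[R]_n -> 'rV[R]_n))%type.
Local Notation wd := (@with_diff R m T M).
Local Notation Om2 := (manifold_interior M).
Local Notation mu := (tuple_measure R n).
Variables (K : set T) (w : T -> R).
Hypotheses (cK : closed K) (KM : K `<=` Om2) (sw : smooth_fun M K w).
Hypothesis w0 : forall p, (K `\` interior K) p -> w p = 0.
Local Notation Om := (interior K).

Let aK := admissible_interior KM.

Let s (i : chart) (t : tup) := w (psi i (vec t)).
Let q (g : tensor M) (i : chart) (t : tup) := inner g i (vec t) ((wd w).2 i (vec t)) ((wd w).2 i (vec t)).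

(** By [null_critical], for each coordinate the zeros of [w] with nonvanishing partial derivative
    form a null set; there are finitely many coordinates. *)
Lemma ae_critical i : {ae mu, forall t, piece Om i t ->
  s i t = 0 -> (wd w).2 i (vec t) = 0}.
Proof.
have [_ mO _] := aK; have [m1 m2] := mfield_with_diff aK sw.
pose N a := [set t | [/\ piece Om i t, (w \o psi i) (vec t) = 0 &
  partial a (w \o psi i) (vec t) != 0]].
have mN a : measurable (N a).
  have -> : N a = (piece Om i `&` s i @^-1` [set 0]) `&`
      (piece Om i `&` (fun t => (wd w).2 i (vec t) 0 a) @^-1` ~` [set 0]).
    apply/seteqP; split=> [t [pt wt dt]|t [[pt wt] [_ dt]]].
      by split; split=> //=; rewrite mxE; exact/eqP.
    by split=> //; move: dt => /=; rewrite mxE => /eqP.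
  apply: measurableI.
    exact: (m1 i (measurable_piece i mO) [set 0] (measurable_set1 0)).
  exact: (m2 a i (measurable_piece i mO) _ (measurableC (measurable_set1 0))).
have N0 a : mu (N a) = 0%E.
  by apply: null_critical (mN a) => t pt; exact: (smooth_fun_derivable aK sw pt).
have Na a : {ae mu, forall t, piece Om i t -> s i t = 0 -> (wd w).2 i (vec t) 0 a = 0}.
  exists (N a); split=> // t /not_implyP[pt /not_implyP[st]].
  by rewrite mxE => /eqP dt; split.
have := filter_forall (ae_filter_ringOfSetsType mu) Na.
apply: filterS => t H pt st.
by apply/rowP => a; rewrite [RHS]mxE; exact: H.
Qed.

(** Dominated convergence on each piece. The majorant is 36 times the integrand of the energy of
    [w], by [chi_sub_sqr] and [dchi_sub_sqr]. *)
Lemma energy_truncation_cvg g : riemannian g -> (energy g Om (wd w) < +oo)%E ->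
  energy g Om2 (wd (truncation K w l) - ext0 Om (wd w)) @[l --> \oo] --> 0%E.
Proof.
move=> rg foo; have [OM mO _] := aK.
have mw := mfield_with_diff aK sw.
under eq_fun => l do rewrite (energy_truncation cK KM sw w0) integral_volE.
have e0 : (\sum_(i < charts M) 0 = 0 :> \bar R)%E by rewrite big1.
rewrite -[X in nbhs X]e0; apply: cvg_nnesum => i _.
  apply: nearW => l; apply: integral_ge0 => t pt; rewrite lee_fin mulr_ge0 ?density_ge0//.
  by rewrite addr_ge0 ?sqr_ge0// mulr_ge0 ?sqr_ge0// inner_ge0//; case: pt.
have mp := measurable_piece i mO.
pose f l (t : tup) : \bar R := (((chi l.+1%:R (s i t) - s i t) ^+ 2 +
  (dchi l.+1%:R (s i t) - 1) ^+ 2 * q g i t) * density g i (vec t))%:E.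
pose G (t : tup) : \bar R := (36%:E * ((s i t ^+ 2 + q g i t) * density g i (vec t))%:E)%E.
have iG : mu.-integrable (piece Om i) G.
  have Ew := energy_piece_fun rg mw.
  apply: integrableZl => //; move: i {mp f G}; apply: (integrable_volP rg mO Ew Ew) => // i t pt.
  by rewrite ger0_norm// (energy_fun_ge0 _ rg pt).
have mf l : measurable_fun (piece Om i) (f l).
  have ms : measurable_fun (piece Om i) (s i) := mw.1 i.
  apply/measurable_EFinP; apply: measurable_funM; last exact: measurable_piece_density.
  apply: measurable_funD.
    apply: measurable_funX; apply: measurable_funB => //.
    apply: measurableT_comp ms; exact: measurable_chi.
  apply: measurable_funM; last exact: (measurable_piece_inner rg mw mw).
  apply: measurable_funX; apply: measurable_funB => //.
  apply: measurableT_comp ms; exact: measurable_dchi.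
have q0 t : piece Om i t -> 0 <= q g i t.
  by move=> pt; apply: inner_ge0 => //; case: pt.
have fG : {ae mu, forall t l, piece Om i t -> (`|f l t| <= G t)%E}.
  apply: aeW => t l pt; rewrite /f /G /= lee_fin.
  have d0 := density_ge0 g i (vec t); have qt := q0 t pt.
  rewrite ger0_norm; last by rewrite mulr_ge0// addr_ge0 ?sqr_ge0// mulr_ge0// sqr_ge0.
  rewrite mulrA ler_wpM2r//.
  have := chi_sub_sqr l.+1%:R (s i t); have := sqr_ge0 (s i t).
  have := ler_wpM2r qt (dchi_sub_sqr l.+1%:R (s i t)); lra.
have f0 : {ae mu, forall t, piece Om i t -> f l t @[l --> \oo] --> 0%E}.
  have := ae_critical i; apply: filterS => t H pt.
  apply: cvg_EFin; first exact: nearW.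
  rewrite [X in _ --> X](_ : 0 = ((s i t - s i t) ^+ 2 + 0) * density g i (vec t)); last first.
    by rewrite subrr expr0n addr0 mul0r.
  have c1 : (chi l.+1%:R (s i t) - s i t) @[l --> \oo] --> (s i t - s i t).
    by apply: cvgB; [exact: cvg_chi|exact: cvg_cst].
  apply: cvgMr_tmp; apply: cvgD.
    exact: (cvg_comp _ _ c1 (@exprn_continuous R 2 _)).
  (* On the zero set of [w] the differential vanishes almost everywhere; off it [dchi] tends to
     1. *)
  have [st|st] := eqVneq (s i t) 0.
    rewrite /q (H pt st) innerE qform0l; under eq_fun do rewrite mulr0; exact: cvg_cst.
  have c2 : (dchi l.+1%:R (s i t) - 1) @[l --> \oo] --> (1 - 1 : R).
    by apply: cvgB; [exact: cvg_dchi|exact: cvg_cst].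
  rewrite [X in _ --> X](_ : 0 = (1 - 1) ^+ 2 * q g i t); last first.
    by rewrite subrr expr0n mul0r.
  apply: cvgMr_tmp; exact: (cvg_comp _ _ c2 (@exprn_continuous R 2 _)).
have [_ _] := dominated_convergence mp mf (measurable_cst 0%E) f0 iG fG.
by rewrite integral0.
Qed.

Lemma approx_ext0 g (e : R) : riemannian g -> (energy g Om (wd w) < +oo)%E -> 0 < e ->
  exists W, [/\ smooth_fun M [set: T] W, forall p, ~ Om p -> W p = 0 &
    (energy g Om2 (wd W - ext0 Om (wd w))%R < e%:E)%E].
Proof.
move=> rg foo e0.
have H := energy_truncation_cvg rg foo.
have : \forall l \near \oo, (energy g Om2 (wd (truncation K w l) - ext0 Om (wd w))%R < e%:E)%E.
  have e0' : nbhs (0%E : \bar R) [set y | (y < e%:E)%E].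
    by apply: open_nbhs_nbhs; split; [exact: open_ereal_lt_ereal|rewrite /= lte_fin].
  exact: (H _ e0').
move=> /filter_ex[l Hl]; exists (truncation K w l); split=> //.
  exact: smooth_truncation.
by move=> p nO; exact: truncation_out.
Qed.

End TruncationCvg.

(** * Sobolev functions and traces *)

Section Sobolev.
Variables (R : realType) (m : nat) (T : topologicalType).
Variable M : compact_manifold R m T.
Local Notation n := m.+1.
Local Notation chart := 'I_(charts M).
Local Notation FD := ((T -> R) * (chart -> 'rV[R]_n -> 'rV[R]_n))%type.
Local Notation wd := (@with_diff R m T M).
Implicit Types (Om K : set T) (g : tensor M) (u v : FD) (f h : nat -> T -> R).

Lemma energy0 g Om : riemannian g -> energy g Om (0 : FD) = 0%E.
Proof.
move=> rg; rewrite /energy integral_volE big1// => i _.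
apply: integral0_eq => t _.
have -> : inner g i (vec t) ((0 : FD).2 i (vec t)) ((0 : FD).2 i (vec t)) = 0.
  exact: (qform0l (g i (vec t)) 0).
have -> : (0 : FD).1 (psi i (vec t)) = 0 by [].
by rewrite expr0n addr0 mul0r.
Qed.

Lemma cvge0_le2 (a b c : nat -> \bar R) : (forall k, 0 <= a k)%E ->
  (\forall k \near \oo, a k <= 2%:E * b k + 2%:E * c k)%E ->
  b k @[k --> \oo] --> 0%E -> c k @[k --> \oo] --> 0%E -> a k @[k --> \oo] --> 0%E.
Proof.
move=> a0 abc b0 c0.
have cM (d : nat -> \bar R) : d k @[k --> \oo] --> 0%E -> (2%:E * d k)%E @[k --> \oo] --> 0%E.
  by move=> d0; have := cvgeZl (y := 2%:E) isT d0; rewrite mule0.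
have s0 : (2%:E * b k + 2%:E * c k)%E @[k --> \oo] --> 0%E.
  by have := cvgeD (a := 0%E) (b := 0%E) isT (cM b b0) (cM c c0); rewrite adde0; exact.
apply: (@squeeze_cvge _ _ _ _ (fun=> 0%E) _ (fun k => (2%:E * b k + 2%:E * c k)%E)) => //.
  by apply: filterS abc => k ->; rewrite a0.
exact: cvg_cst.
Qed.

Lemma H1_cvgP Om f u : H1_cvg Om f u <-> forall g, riemannian g ->
  energy g Om (wd (f k) - u) @[k --> \oo] --> 0%E.
Proof. by []. Qed.

Section Admissible.
Variables (K Om : set T).
Hypothesis aK : admissible M K Om.
Local Notation smooth := (smooth_fun M K).

Let mO : measurable_region M Om. Proof. by case: aK. Qed.

Lemma mfield_wdB f u k : smooth (f k) -> mfield u Om -> mfield (wd (f k) - u) Om.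
Proof. by move=> sf mu; apply: mfieldB => //; exact: (mfield_with_diff aK sf). Qed.

Lemma H1_cvgD f h u v : (forall k, smooth (f k)) -> (forall k, smooth (h k)) ->
  mfield u Om -> mfield v Om -> H1_cvg Om f u -> H1_cvg Om h v ->
  H1_cvg Om (fun k => f k + h k) (u + v).
Proof.
move=> sf sh mu mv /H1_cvgP fu /H1_cvgP hv; apply/H1_cvgP => g rg.
have e0 k : (0 <= energy g Om (wd (f k + h k) - (u + v))%R)%E by exact: energy_ge0.
apply: (cvge0_le2 e0 _ (fu g rg) (hv g rg)); apply: nearW => k.
rewrite (_ : energy g Om (wd (f k + h k) - (u + v)) =
    energy g Om ((wd (f k) - u) + (wd (h k) - v))).
  by apply: energyD_le => //; exact: mfield_wdB.
apply: eq_energy => i t pt; have [e1 e2] := with_diffD aK (sf k) (sh k) pt.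
rewrite addrACA -opprD; split.
  by rewrite -[LHS]/((wd (f k + h k)).1 (psi i (vec t)) - (u + v).1 (psi i (vec t))) e1.
by rewrite -[LHS]/((wd (f k + h k)).2 i (vec t) - (u + v).2 i (vec t)) e2.
Qed.

Lemma H1_cvgN f u : (forall k, smooth (f k)) -> H1_cvg Om f u ->
  H1_cvg Om (fun k => - f k) (- u).
Proof.
move=> sf /H1_cvgP fu; apply/H1_cvgP => g rg.
rewrite (_ : (fun k => _) = fun k => energy g Om (wd (f k) - u)); first exact: fu.
apply/funext => k; rewrite -[RHS]energyN opprB addrC opprK.
apply: eq_energy => i t pt; have [e1 e2] := with_diffN aK (sf k) pt.
split.
  by rewrite -[LHS]/(u.1 (psi i (vec t)) + (wd (- f k)).1 (psi i (vec t))) e1.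
by rewrite -[LHS]/(u.2 i (vec t) + (wd (- f k)).2 i (vec t)) e2.
Qed.

Lemma H1_cvgB f h u v : (forall k, smooth (f k)) -> (forall k, smooth (h k)) ->
  mfield u Om -> mfield v Om -> H1_cvg Om f u -> H1_cvg Om h v ->
  H1_cvg Om (fun k => f k - h k) (u - v).
Proof.
move=> sf sh mu mv fu hv.
exact: (H1_cvgD sf (fun k => smooth_funN (sh k)) mu (mfieldN mv) fu (H1_cvgN sh hv)).
Qed.

Lemma H1_cvg0 : H1_cvg Om (fun=> cst 0) (zero_diff M).
Proof.
apply/H1_cvgP => g rg; under eq_fun do rewrite -/(zero_diff M) subrr energy0//.
exact: cvg_cst.
Qed.

Lemma H1_mfield u : H1 K Om u -> mfield u Om.
Proof. by move=> [u1 u2 _ _]; split=> [i|a i]; [exact: u1|exact: u2]. Qed.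

Lemma H1_energy g u : riemannian g -> H1 K Om u -> (energy g Om u < +oo)%E.
Proof.
move=> rg [_ _ eu _]; have : (H1_sqdist g Om u (zero_diff M) < +oo)%E := eu g rg.
by rewrite H1_sqdistE zero_diffE subr0.
Qed.

Lemma H1P u f : mfield u Om -> (forall g, riemannian g -> (energy g Om u < +oo)%E) ->
  (forall k, smooth (f k)) -> H1_cvg Om f u -> H1 K Om u.
Proof.
move=> [u1 u2] ue sf fu; split; [exact: u1|by move=> i a; exact: u2| |by exists f].
move=> g rg; rewrite -/(H1_sqdist g Om u (zero_diff M)) H1_sqdistE zero_diffE subr0.
exact: ue.
Qed.

Lemma energyD_lty g u v : riemannian g -> mfield u Om -> mfield v Om ->
  (energy g Om u < +oo)%E -> (energy g Om v < +oo)%E -> (energy g Om (u + v)%R < +oo)%E.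
Proof.
move=> rg mu mv eu ev; apply: le_lt_trans (energyD_le rg mO mu mv) _.
by apply: lte_add_pinfty; rewrite lte_mul_pinfty// ?lee_fin// ?fin_numE.
Qed.

Lemma H1B u v : H1 K Om u -> H1 K Om v -> H1 K Om (u - v).
Proof.
move=> Hu Hv; have [_ _ _ [f sf fu]] := Hu; have [_ _ _ [h sh hv]] := Hv.
have mu := H1_mfield Hu; have mv := H1_mfield Hv.
apply: (@H1P _ (fun k => f k - h k)).
- exact: mfieldB.
- move=> g rg; apply: energyD_lty => //; [exact: mfieldN|exact: H1_energy|].
  by rewrite energyN; exact: H1_energy.
- by move=> k; apply: smooth_funD => //; exact: smooth_funN.
- exact: H1_cvgB.
Qed.

Lemma H1_zero : H1 K Om (zero_diff M).
Proof.
apply: (@H1P _ (fun=> cst 0)).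
- have H : mfield (wd (cst 0)) Om := mfield_with_diff aK (@smooth_fun_cst _ _ _ M K 0).
  exact: H.
- by move=> g rg; rewrite zero_diffE energy0.
- by move=> _; exact: smooth_fun_cst.
- exact: H1_cvg0.
Qed.

Lemma H1D u v : H1 K Om u -> H1 K Om v -> H1 K Om (u + v).
Proof.
move=> Hu Hv; have H0 : H1 K Om (0 : FD) by rewrite -zero_diffE; exact: H1_zero.
by have := H1B Hu (H1B H0 Hv); rewrite sub0r opprK; apply.
Qed.

Lemma same_trace_refl u : H1 K Om u -> same_trace K Om u u.
Proof. by move=> [_ _ _ [f sf fu]]; exists f, f; split. Qed.

Lemma same_trace_sym u v : same_trace K Om u v -> same_trace K Om v u.
Proof. by move=> [f [h [sf sh fh fu hv]]]; exists h, f; split=> // k p /fh. Qed.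

Lemma same_traceB u v u' v' : H1 K Om u -> H1 K Om v -> H1 K Om u' -> H1 K Om v' ->
  same_trace K Om u v -> same_trace K Om u' v' -> same_trace K Om (u - u') (v - v').
Proof.
move=> /H1_mfield mu /H1_mfield mv /H1_mfield mu' /H1_mfield mv'.
move=> [f [h [sf sh fh fu hv]]] [f' [h' [sf' sh' fh' fu' hv']]].
exists (fun k => f k - f' k), (fun k => h k - h' k); split.
- by move=> k; apply: smooth_funD => //; exact: smooth_funN.
- by move=> k; apply: smooth_funD => //; exact: smooth_funN.
- by move=> k p Kp; rewrite -[LHS]/(f k p - f' k p) fh// fh'.
- exact: H1_cvgB.
- exact: H1_cvgB.
Qed.

Lemma same_traceD u v u' v' : H1 K Om u -> H1 K Om v -> H1 K Om u' -> H1 K Om v' ->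
  same_trace K Om u v -> same_trace K Om u' v' -> same_trace K Om (u + u') (v + v').
Proof.
move=> /H1_mfield mu /H1_mfield mv /H1_mfield mu' /H1_mfield mv'.
move=> [f [h [sf sh fh fu hv]]] [f' [h' [sf' sh' fh' fu' hv']]].
exists (fun k => f k + f' k), (fun k => h k + h' k); split.
- by move=> k; exact: smooth_funD.
- by move=> k; exact: smooth_funD.
- by move=> k p Kp; rewrite -[LHS]/(f k p + f' k p) fh// fh'.
- exact: H1_cvgD.
- exact: H1_cvgD.
Qed.

(** The two approximations of [v] may differ, so [u] is approximated by f - h + f', which has limit
    u - v + v and the boundary values of f', that is, of h'. *)
Lemma same_trace_trans u v w : H1 K Om u -> H1 K Om v -> H1 K Om w ->
  same_trace K Om u v -> same_trace K Om v w -> same_trace K Om u w.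
Proof.
move=> /H1_mfield mu /H1_mfield mv /H1_mfield mw.
move=> [f [h [sf sh fh fu hv]]] [f' [h' [sf' sh' fh' fv hw]]].
have sB k : smooth (f k - h k) by apply: smooth_funD => //; exact: smooth_funN.
exists (fun k => f k - h k + f' k), h'; split.
- by move=> k; exact: smooth_funD.
- exact: sh'.
- by move=> k p Kp; rewrite -[LHS]/(f k p - h k p + f' k p) fh// subrr add0r fh'.
- have := H1_cvgD sB sf' (mfieldB mu mv) mv (H1_cvgB sf sh mu mv fu hv) fv.
  by rewrite subrK.
- exact: hw.
Qed.

(** Having the same trace is an equivalence relation on H^1, and [trace] is the equivalence
    class. *)
Lemma trace_eqP u v : H1 K Om u -> H1 K Om v ->
  trace K Om u = trace K Om v <-> same_trace K Om u v.
Proof.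
move=> Hu Hv; split=> [uv|uv].
  have tv : trace K Om v v by split; [exact: Hv|exact: same_trace_refl].
  by move: tv; rewrite -uv => -[_]; apply.
apply/seteqP; split=> w [Hw sw]; (split; first exact: Hw).
  exact: (same_trace_trans Hv Hu Hw (same_trace_sym uv) sw).
exact: (same_trace_trans Hu Hv Hw uv sw).
Qed.

Lemma integrable_inner g u v : riemannian g -> mfield u Om -> mfield v Om ->
  (energy g Om u < +oo)%E -> (energy g Om v < +oo)%E ->
  integrable_vol g Om (fun i x => inner g i x (u.2 i x) (v.2 i x)).
Proof.
move=> rg mu mv eu ev.
have Eu := energy_piece_fun rg mu; have Ev := energy_piece_fun rg mv.
apply: (integrable_volP rg mO (measurable_piece_inner rg mu mv)
  (F' := fun i x => (u.1 (psi i x) ^+ 2 + inner g i x (u.2 i x) (u.2 i x)) +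
    (v.1 (psi i x) ^+ 2 + inner g i x (v.2 i x) (v.2 i x)))).
- by move=> i; exact: (measurable_funD (Eu i) (Ev i)).
- move=> i t pt; have Ax : (phi i @` dom i) (vec t) by case: pt.
  have := qform_abs_le (riemannian_sym rg Ax) (riemannian_posdef rg Ax)
    (u.2 i (vec t)) (v.2 i (vec t)).
  rewrite -!innerE; have := sqr_ge0 (u.1 (psi i (vec t))).
  have := sqr_ge0 (v.1 (psi i (vec t))); lra.
- rewrite integral_volD//; first exact: lte_add_pinfty.
    by move=> i t pt; exact: (energy_fun_ge0 _ rg pt).
  by move=> i t pt; exact: (energy_fun_ge0 _ rg pt).
Qed.

Lemma integrable_dirichlet g u v : riemannian g -> H1 K Om u -> H1 K Om v ->
  integrable_vol g Om (fun i x => inner g i x (u.2 i x) (v.2 i x)).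
Proof.
by move=> rg Hu Hv; apply: integrable_inner => //; try exact: H1_mfield; exact: H1_energy.
Qed.

Lemma dirichlet_fin_num g u v : riemannian g -> H1 K Om u -> H1 K Om v ->
  dirichlet g Om u v \is a fin_num.
Proof. by move=> rg Hu Hv; apply: integrable_vol_fin_num => //; exact: integrable_dirichlet. Qed.

Lemma dirichletBr g u v v' : riemannian g -> H1 K Om u -> H1 K Om v -> H1 K Om v' ->
  dirichlet g Om u (v - v') = (dirichlet g Om u v - dirichlet g Om u v')%E.
Proof.
move=> rg Hu Hv Hv'; rewrite /dirichlet -integrable_integral_volB//.
- by apply: eq_integral_vol => i t _; rewrite !innerE qformDr qformNr.
- exact: integrable_dirichlet.
- exact: integrable_dirichlet.
Qed.

End Admissible.
End Sobolev.

(** * Gluing *)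

Section Gluing.
Variables (R : realType) (m : nat) (T : topologicalType).
Variable M : compact_manifold R m T.
Local Notation n := m.+1.
Local Notation chart := 'I_(charts M).
Local Notation FD := ((T -> R) * (chart -> 'rV[R]_n -> 'rV[R]_n))%type.
Local Notation wd := (@with_diff R m T M).
Local Notation Om2 := (manifold_interior M).
Variable K : set T.
Hypotheses (cK : closed K) (KM : K `<=` Om2).
Local Notation Om := (interior K).
Implicit Types (g : tensor M) (u v : FD).

Let a1 : admissible M K Om := admissible_interior KM.
Let a2 : admissible M [set: T] Om2 := admissible_full M.
Let m1 : measurable_region M Om. Proof. by case: a1. Qed.
Let m2 : measurable_region M Om2. Proof. by case: a2. Qed.
Let OM : Om `<=` Om2. Proof. by apply: subset_trans KM; exact: interior_subset. Qed.

Lemma H1_restrict u : H1 [set: T] Om2 u -> H1 K Om u.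
Proof.
move=> Hu; have mu2 := H1_mfield Hu; have [_ _ _ [f sf fu]] := Hu.
have mu1 : mfield u Om := mfieldS m2 OM mu2.
apply: (@H1P _ _ _ _ _ _ _ f mu1).
- by move=> g rg; apply: le_lt_trans (H1_energy rg Hu); exact: (energyS rg m1 m2 OM mu2).
- by move=> k; apply: smooth_funS (sf k).
- move/H1_cvgP in fu; apply/H1_cvgP => g rg.
  apply: (squeeze_cvge _ (cvg_cst 0%E) (fu g rg)); apply: nearW => k.
  rewrite energy_ge0//=.
  exact: (energyS rg m1 m2 OM (mfield_wdB a2 (sf k) mu2)).
Qed.

(** The differences [w k] of the two approximating sequences vanish on the boundary of [K] and tend
    to [v]. Truncation replaces each by a smooth [W k] on the whole manifold, within 1/(k+1) for the
    single metric [g0]; [energy_compare] carries the estimate to every metric. *)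
Lemma ext0_trace0 g0 v : riemannian g0 -> H1 K Om v -> same_trace K Om v (zero_diff M) ->
  H1 [set: T] Om2 (ext0 Om v) /\ same_trace [set: T] Om2 (ext0 Om v) (zero_diff M).
Proof.
move=> rg0 Hv [f [h [sf sh fh fv h0]]].
have mv := H1_mfield Hv.
have mz := H1_mfield (H1_zero a1).
pose w k := f k - h k.
have sw k : smooth_fun M K (w k) by apply: smooth_funD => //; exact: smooth_funN.
have w0 k p : (K `\` Om) p -> w k p = 0.
  by move=> Kp; rewrite -[LHS]/(f k p - h k p) fh// subrr.
have wv : H1_cvg Om w v.
  by have := H1_cvgB a1 sf sh mv mz fv h0; rewrite zero_diffE subr0.
have mw k : mfield (wd (w k)) Om := mfield_with_diff a1 (sw k).
(* The estimate is conditional on finite energy, with the zero function as default; finiteness is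
   established below for large [k] only. *)
have /choice[W HW] k : exists W, [/\ smooth_fun M [set: T] W, forall p, ~ Om p -> W p = 0 &
    (energy g0 Om (wd (w k)) < +oo ->
     energy g0 Om2 (wd W - ext0 Om (wd (w k)))%R < (k.+1%:R^-1)%:E)%E].
  have [foo|nfoo] := pselect (energy g0 Om (wd (w k)) < +oo)%E.
    have e0 : 0 < k.+1%:R^-1 :> R by rewrite invr_gt0.
    by have [W [W1 W2 W3]] := approx_ext0 cK KM (sw k) (w0 k) rg0 foo e0; exists W.
  by exists (cst 0); split=> //; exact: smooth_fun_cst.
have sW k : smooth_fun M [set: T] (W k) by have [] := HW k.
have mW k : mfield (wd (W k)) Om2 := mfield_with_diff a2 (sW k).
have mE : mfield (ext0 Om v) Om2 := mfield_ext0 m1 m2 OM mv.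
have mEw k : mfield (ext0 Om (wd (w k))) Om2 := mfield_ext0 m1 m2 OM (mw k).
have Wv : H1_cvg Om2 W (ext0 Om v).
  apply/H1_cvgP => g rg.
  have e0 k : (0 <= energy g Om2 (wd (W k) - ext0 Om v)%R)%E by exact: energy_ge0.
  have A2 : energy g Om (wd (w k) - v) @[k --> \oo] --> 0%E := (H1_cvgP _ _ _).1 wv g rg.
  have A1 : energy g Om2 (wd (W k) - ext0 Om (wd (w k))) @[k --> \oo] --> 0%E.
    have [C C0 HC] := energy_compare rg rg0.
    have Ck : (C%:E * (k.+1%:R^-1)%:E : \bar R)%E @[k --> \oo] --> 0%E.
      have H : ((k.+1%:R^-1 : R)%:E) @[k --> \oo] --> 0%E.
        by apply: cvg_EFin; [exact: nearW|exact: cvg_harmonic].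
      by have := cvgeZl (y := C%:E) isT H; rewrite mule0.
    (* Once [w k] is at distance less than 1 from [v], its energy is finite and the estimate on
       [W k] becomes available. *)
    have ew : \forall k \near \oo, (energy g0 Om (wd (w k) - v)%R < 1%:E)%E.
      have n1 : nbhs (0%E : \bar R) [set y | (y < 1%:E)%E].
        by apply: open_nbhs_nbhs; split; [exact: open_ereal_lt_ereal|rewrite /= lte_fin].
      exact: ((H1_cvgP _ _ _).1 wv g0 rg0 _ n1).
    apply: (squeeze_cvge _ (cvg_cst 0%E) Ck).
    apply: filterS ew => k ek; rewrite energy_ge0//=.
    apply: le_trans (HC Om2 _ (@subset_refl _ _) m2 (mfieldB (mW k) (mEw k))) _.
    apply: lee_wpmul2l; first by rewrite lee_fin.
    apply/ltW; have [_ _] := HW k; apply.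
    rewrite -(subrK v (wd (w k))).
    apply: (energyD_lty a1 rg0 (mfieldB (mw k) mv) mv).
      by apply: lt_trans ek _; rewrite ltry.
    exact: (H1_energy rg0 Hv).
  apply: (cvge0_le2 e0 _ A1 A2); apply: nearW => k.
  (* Extension by zero is linear and preserves the energy, so the distance from [w k] to [v] is also
     that of their extensions. *)
  rewrite -(energy_ext0 _ (wd (w k) - v) OM) ext0B.
  have -> : wd (W k) - ext0 Om v = (wd (W k) - ext0 Om (wd (w k))) +
     (ext0 Om (wd (w k)) - ext0 Om v) by rewrite subrKA.
  exact: (energyD_le rg m2 (mfieldB (mW k) (mEw k)) (mfieldB (mEw k) mE)).
split.
  apply: (H1P mE _ sW Wv) => g rg; rewrite energy_ext0//; exact: (H1_energy rg Hv).
exists W, (fun=> cst 0); split.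
- exact: sW.
- by move=> _; exact: smooth_fun_cst.
- by move=> k p [_ nO]; have [_ -> //] := HW k; move=> /OM.
- exact: Wv.
- exact: H1_cvg0.
Qed.

End Gluing.

(** * Comparison of the Dirichlet-to-Neumann maps *)

Section Main.
Variables (R : realType) (m : nat) (T : topologicalType).
Variable M : compact_manifold R m T.
Local Notation n := m.+1.
Local Notation chart := 'I_(charts M).
Local Notation FD := ((T -> R) * (chart -> 'rV[R]_n -> 'rV[R]_n))%type.
Local Notation Om2 := (manifold_interior M).
Variable K : set T.
Hypotheses (cK : closed K) (KM : K `<=` Om2).
Local Notation Om := (interior K).
Implicit Types (u v : FD).

Let a1 : admissible M K Om := admissible_interior KM.
Let a2 : admissible M [set: T] Om2 := admissible_full M.
Let m1 : measurable_region M Om. Proof. by case: a1. Qed.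
Let m2 : measurable_region M Om2. Proof. by case: a2. Qed.
Let OM : Om `<=` Om2. Proof. by apply: subset_trans KM; exact: interior_subset. Qed.

Section TwoMetrics.
Variables G Gt : tensor M.
Hypotheses (rG : riemannian G) (rGt : riemannian Gt).
Hypothesis GGt : forall (i : chart) p, dom i p -> ~ K p -> G i (phi i p) = Gt i (phi i p).

(** Equality is assumed off [K] and is extended to its boundary by continuity: if the metrics differ
    at [p], they differ near [p], so a neighbourhood of [p] lies in [K] and [p] is interior. *)
Lemma metrics_eq_outside (i : chart) p : dom i p -> ~ Om p -> G i (phi i p) = Gt i (phi i p).
Proof.
move=> dp nO; have Ap : (phi i @` dom i) (phi i p) by exists p.
apply/matrixP => a b; apply/eqP; rewrite -subr_eq0; apply: contraT => ne.
have cD : cwithin (phi i @` dom i) (fun x => G i x a b - Gt i x a b).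
  apply: cwithinD; first exact: riemannian_cwithin.
  apply: (@cwithin_eq _ _ _ (fun x => -1 * Gt i x a b)).
    by move=> x _; rewrite mulN1r.
  by apply: cwithinM; [exact: cwithin_cst|exact: riemannian_cwithin].
have oN : nbhs (G i (phi i p) a b - Gt i (phi i p) a b) [set y : R | y != 0].
  by apply: open_nbhs_nbhs; split => //; exact: open_neq.
have Dn : nbhs (phi i p) [set x | (phi i @` dom i) x -> G i x a b - Gt i x a b != 0] :=
  cD _ Ap _ oN.
have /subspace_continuousP/(_ p dp) cphi := @phi_continuous _ _ _ M i.
have Dp : nbhs p [set q | dom i q -> (phi i @` dom i) (phi i q) ->
  G i (phi i q) a b - Gt i (phi i q) a b != 0] := cphi _ Dn.
have di : nbhs p (dom i) := open_nbhs_nbhs (conj (@dom_open _ _ _ M i) dp).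
exfalso; apply: nO; rewrite /interior.
apply: filterS2 Dp di => q Dq dq; apply: contrapT => nKq.
have := Dq dq (ex_intro2 _ _ q dq erefl).
by rewrite (GGt dq nKq) subrr eqxx.
Qed.

Lemma DN_map_sub : DN_map G K Om `<=` DN_map Gt K Om ->
  DN_map G [set: T] Om2 `<=` DN_map Gt [set: T] Om2.
Proof.
move=> sub [F L] [u [Hu tu hu Lu]]; rewrite /= in tu Lu.
have Hu1 := H1_restrict KM Hu.
have hu1 : weak_harmonic G K Om u.
  move=> v Hv v0; have [HE E0] := ext0_trace0 cK KM rG Hv v0.
  rewrite -(hu _ HE E0) /dirichlet (integral_vol_support _ OM).
    by apply: eq_integral_vol => i t pt; have [_ ->] := ext0_in v pt.
  move=> i t _ nO; have [_ ->] := ext0_out v nO.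
  by rewrite innerE qform0r.
pose F1 : Hhalf M K Om := exist _ (trace K Om u) (ex_intro2 _ _ u Hu1 erefl).
(* A representative is chosen for each boundary value, which turns the pairing with [u] into a
   function on [Hhalf]; [fine] loses nothing because Dirichlet integrals of H^1 elements are
   finite. *)
pose rep (h : Hhalf M K Om) : FD := s2val (cid2 (svalP h)).
have repH h : H1 K Om (rep h) by rewrite /rep; case: cid2.
have repE h : sval h = trace K Om (rep h) by rewrite /rep; case: cid2.
pose L1 (h : Hhalf M K Om) : R := fine (dirichlet G Om u (rep h)).
have L1E h v : H1 K Om v -> trace K Om v = sval h -> (L1 h)%:E = dirichlet G Om u v.
  move=> Hv tv.
  rewrite /L1 fineK; last exact: (dirichlet_fin_num a1 rG Hu1 (repH h)).
  have st : same_trace K Om (rep h) v.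
    by apply/(trace_eqP a1 (repH h) Hv); rewrite tv -repE.
  (* The difference [rep h - v] has trace zero, so harmonicity of [u] makes the functional
     independent of the representative. *)
  have st0 := same_traceB a1 (repH h) Hv Hv Hv st (same_trace_refl Hv).
  have := hu1 _ (H1B a1 (repH h) Hv).
  rewrite zero_diffE -[0](subrr v) => /(_ st0).
  rewrite (dirichletBr a1 rG Hu1 (repH h) Hv).
  have f1 := dirichlet_fin_num a1 rG Hu1 (repH h).
  have f2 := dirichlet_fin_num a1 rG Hu1 Hv.
  by rewrite -(fineK f1) -(fineK f2) -EFinB => -[] /subr0_eq ->.
have : DN_map Gt K Om (F1, L1).
  by apply: sub; exists u; split; [exact: Hu1|by []|exact: hu1|exact: L1E].
move=> [w [Hw tw _ Lw]]; rewrite /= in tw Lw.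
have wu0 : same_trace K Om (w - u) (zero_diff M).
  have st := (trace_eqP a1 Hw Hu1).1 tw.
  have := same_traceB a1 Hw Hu1 Hu1 Hu1 st (same_trace_refl Hu1).
  by rewrite subrr zero_diffE.
have [HE E0] := ext0_trace0 cK KM rG (H1B a1 Hw Hu1) wu0.
(* Gluing is written as a sum, so that membership in H^1 and the boundary values follow from
   linearity and [ext0_trace0]. *)
pose z : FD := u + ext0 Om (w - u).
have Hz : H1 [set: T] Om2 z by exact: (H1D a2).
have zu : same_trace [set: T] Om2 z u.
  have := same_traceD a2 Hu Hu HE (H1_zero a2) (same_trace_refl Hu) E0.
  by rewrite zero_diffE addr0; apply.
have key v : H1 [set: T] Om2 v -> dirichlet Gt Om2 z v = dirichlet G Om2 u v.
  move=> Hv; have Hv1 := H1_restrict KM Hv.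
  rewrite /dirichlet.
  rewrite (integral_vol_split m1 m2 OM (integrable_dirichlet a2 rGt Hz Hv)).
  rewrite (integral_vol_split m1 m2 OM (integrable_dirichlet a2 rG Hu Hv)).
  congr (_ + _)%E.
    transitivity (dirichlet Gt Om w v).
      apply: eq_integral_vol => i t pt; congr (inner _ _ _ _ _ * _).
      have [_ e] := ext0_in (w - u) pt.
      by rewrite -[LHS]/(u.2 i (vec t) + (ext0 Om (w - u)).2 i (vec t)) e addrC subrK.
    (* Both integrals over [Om] are the value of the common functional at the trace of [v]. *)
    pose h : Hhalf M K Om := exist _ (trace K Om v) (ex_intro2 _ _ v Hv1 erefl).
    by rewrite -(Lw h v Hv1 erefl) (L1E h v Hv1 erefl).
  apply: eq_integral_vol => i t pt; have [dp [_ nO] pE] := piece_point pt.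
  have [_ e] := ext0_out (w - u) nO.
  have -> : z.2 i (vec t) = u.2 i (vec t).
    by rewrite -[LHS]/(u.2 i (vec t) + (ext0 Om (w - u)).2 i (vec t)) e addr0.
  by rewrite /inner /density -pE (metrics_eq_outside dp nO).
(* By [key], the harmonicity of [u] and its functional are inherited by [z] for [Gt]. *)
exists z; split.
- exact: Hz.
- by rewrite /= -tu; apply/(trace_eqP a2 Hz Hu).
- by move=> v Hv v0; rewrite (key v Hv); exact: (hu v Hv v0).
- by move=> h v Hv tv; rewrite (key v Hv); exact: (Lu h v Hv tv).
Qed.

End TwoMetrics.
End Main.

Theorem theorem1p2 (R : realType) (m : nat) (T : topologicalType)
    (M2 : compact_manifold R m T) (M1 : set T) (G Gt : tensor M2)
    (M2_connected : connected [set: T])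
    (M2_boundary : manifold_boundary M2 !=set0)
    (M1_domain : smooth_domain M2 M1)
    (M1_nonempty : M1 !=set0)
    (M1_connected : connected M1)
    (G_riemannian : riemannian G)
    (Gt_riemannian : riemannian Gt)
    (G_eq_Gt : forall (i : 'I_(charts M2)) (p : T), dom i p -> ~ M1 p ->
       G i (phi i p) = Gt i (phi i p)) :
  DN_map G M1 (interior M1) = DN_map Gt M1 (interior M1) ->
  DN_map G [set: T] (manifold_interior M2) =
  DN_map Gt [set: T] (manifold_interior M2).
Proof.
have [cM1 M1int _] := M1_domain.
have closedM1 := compact_closed (@manifold_hausdorff _ _ _ M2) cM1.
(* The hypotheses are symmetric in the two metrics, so each inclusion is an instance of
   [DN_map_sub]. *)
move=> DN1; apply/seteqP; split.
  apply: (DN_map_sub closedM1 M1int G_riemannian Gt_riemannian G_eq_Gt).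
  by rewrite DN1.
apply: (DN_map_sub closedM1 M1int Gt_riemannian G_riemannian).
  by move=> i p di nM1; rewrite G_eq_Gt.
by rewrite DN1.
Qed.
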